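(* The loops $$p_{\alpha,L}(\lambda)=\frac{\lambda-\bar\alpha}{\lambda-\alpha}\,\pi_{\bar L}+\pi_{(L\oplus\bar L)^\perp}+\frac{\lambda-\alpha}{\lambda-\bar\alpha}\,\pi_L,$$ where $\alpha$ ranges over $\mathbb C\setminus\mathbb R$ and $L$ ranges over the isotropic lines in $\mathbb C^n$, generate the group $\mathcal L_-^\tau(\mathrm{SO}(n,\mathbb C),\mathbb C^n)$.
   Context: Let $\langle\cdot,\cdot\rangle$ be the complex bilinear extension to $\mathbb C^n$ of the standard inner product on $\mathbb R^n$, let $\perp$ denote orthogonality with respect to it, and let $\mathrm{SO}(n,\mathbb C)$ be the group of matrices of determinant $1$ preserving it. A subspace is isotropic if $\langle\cdot,\cdot\rangle$ vanishes on it; a line is a one-dimensional complex subspace. For an isotropic line $L$ one has $\mathbb C^n=L\oplus(L\oplus\bar L)^\perp\oplus\bar L$, and $\pi_L,\pi_{(L\oplus\bar L)^\perp},\pi_{\bar L}$ are the corresponding projections. Loops in $\mathrm{SO}(n,\mathbb C)$ are holomorphic maps $g:U\to\mathrm{SO}(n,\mathbb C)$ with $U\subset\mathbb{CP}^1$ open and dense; loops agreeing on an open dense set are identified, and multiplication is pointwise. Let $\tau(A)=\bar A$. The group $\mathcal L_-^\tau(\mathrm{SO}(n,\mathbb C),\mathbb C^n)$ consists of the loops that are rational ($g:\mathbb{CP}^1\to\mathrm{End}(\mathbb C^n)$ meromorphic), negative (holomorphic at $\infty$ with $g(\infty)=\mathrm{Id}$) and satisfy the reality condition $\tau(g(\bar\lambda))=g(\lambda)$.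 The loops $p_{\alpha,L}$ belong to this group and are called simple elements. *)

(* Defs.v *)
From HB Require Import structures.
From mathcomp Require Import all_boot all_order all_algebra.
From mathcomp Require Import sesquilinear.
From mathcomp Require Import all_classical all_reals.
From mathcomp Require Import topology normedtype derive.
From mathcomp Require Import complex.

Set Implicit Arguments.
Unset Strict Implicit.
Unset Printing Implicit Defensive.

Import Order.TTheory GRing.Theory Num.Theory.
Import numFieldNormedType.Exports.

Local Open Scope classical_set_scope.
Local Open Scope quotient_scope.
Local Open Scope ring_scope.

Section LinearAlgebra.
Context {C : numClosedFieldType} {n : nat}.

(* Complex bilinear, not hermitian: no conjugation. *)
Definition dotv (u v : 'cV[C]_n) : C := \sum_i u i 0 * v i 0.

Definition special_orthogonal (A : 'M[C]_n) : Prop :=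
  \det A = 1 /\ forall u v, dotv (A *m u) (A *m v) = dotv u v.

(* Vectors of C^n are columns and endomorphisms act by [A *m v].  Following
   mxalgebra, a subspace is encoded by a square matrix V, as its row space:
   v belongs to it when (v^T <= V)%MS. *)
Definition conj_space (V : 'M[C]_n) : 'M[C]_n := map_mx Num.conj V.

(* The orthogonal complement for [dotv], whose Gram matrix is 1. *)
Definition perp (V : 'M[C]_n) : 'M[C]_n := orthomx idfun 1%:M V.

(* The projection onto V along W; [proj_mx V W] acts on row vectors. *)
Definition proj (V W : 'M[C]_n) : 'M[C]_n := (proj_mx V W)^T.

Record isotropic_line : Type := IsotropicLine {
  line_mx :> 'M[C]_n;
  line_rank : \rank line_mx = 1%N;
  line_isotropic : forall u v : 'cV[C]_n,
    (u^T <= line_mx)%MS -> (v^T <= line_mx)%MS -> dotv u v = 0 }.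

Definition mid_space (L : isotropic_line) : 'M[C]_n :=
  perp (L + conj_space L)%MS.

Definition pi_line (L : isotropic_line) : 'M[C]_n :=
  proj L (mid_space L + conj_space L)%MS.

Definition pi_mid (L : isotropic_line) : 'M[C]_n :=
  proj (mid_space L) (L + conj_space L)%MS.

Definition pi_conj (L : isotropic_line) : 'M[C]_n :=
  proj (conj_space L) (mid_space L + L)%MS.

Lemma dotv_mx u v : (u^T *m v) = (dotv u v)%:M.
Proof.
by apply/matrixP=> i j; rewrite !ord1 !mxE mulr1n; apply: eq_bigr=> k _; rewrite mxE.
Qed.

Lemma special_orthogonalP A : special_orthogonal A <-> \det A = 1 /\ A^T *m A = 1%:M.
Proof.
split=> -[dA oA]; split=> //.
  apply/matrixP=> i j.
  have H u v : dotv u v = (u^T *m v) 0 0 by rewrite dotv_mx mxE mulr1n.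
  have E X : (delta_mx 0 i *m X *m delta_mx j (0 : 'I_1)) (0 : 'I_1) 0 = X i j.
    by rewrite -rowE -colE !mxE.
  have := oA (delta_mx i 0) (delta_mx j 0).
  rewrite !H trmx_mul !mulmxA -(mulmxA _ A^T A) trmx_delta E => ->.
  by rewrite -[_ *m delta_mx j 0](congr1 (mulmx^~ _) (mulmx1 _)) E.
move=> u v; have H x y : dotv x y = (x^T *m y) 0 0 by rewrite dotv_mx mxE mulr1n.
by rewrite !H trmx_mul mulmxA -(mulmxA _ A^T) oA mulmx1.
Qed.

Section Line.
Variable L : isotropic_line.
Let A : 'M[C]_n := L.
Let B := conj_space A.
Let M := perp (A + B)%MS.

Lemma perpP m p (X : 'M_(m, n)) (V : 'M_n) (Y : 'M_(p, n)) :
  (X <= perp V)%MS -> (Y <= V)%MS -> X *m Y^T = 0.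
Proof.
rewrite /perp /orthomx mul1mx map_mx_id // => /sub_kermxP XV /submxP[D ->].
by rewrite trmx_mul mulmxA XV mul0mx.
Qed.

Lemma line_orth m p (X : 'M_(m, n)) (Y : 'M_(p, n)) :
  (X <= A)%MS -> (Y <= A)%MS -> X *m Y^T = 0.
Proof.
move=> XA YA; apply/matrixP=> i j.
have -> : (X *m Y^T) i j = dotv (row i X)^T (row j Y)^T.
  by rewrite !mxE; apply: eq_bigr=> k _; rewrite !mxE.
by rewrite mxE (@line_isotropic L) // trmxK; apply: submx_trans (row_sub _ _) _.
Qed.

Lemma conj_spaceK k m : involutive (map_mx Num.conj : 'M[C]_(k, m) -> 'M_(k, m)).
Proof. by move=> X; apply/matrixP=> i j; rewrite !mxE conjCK. Qed.

Lemma conj_line_orth m p (X : 'M_(m, n)) (Y : 'M_(p, n)) :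
  (X <= B)%MS -> (Y <= B)%MS -> X *m Y^T = 0.
Proof.
move=> XB YB; apply: (inv_inj (@conj_spaceK _ _)).
by rewrite map_mxM map_mx0 -map_trmx line_orth // -[A](conj_spaceK A) map_submx.
Qed.

Lemma mulmx_conj_eq0 m (X : 'M_(m, n)) : X *m (map_mx (Num.conj : C -> C) X)^T = 0 -> X = 0.
Proof.
move=> X0; apply/matrixP=> i j; rewrite mxE.
have /matrixP/(_ i i) := X0; rewrite !mxE => /eqP.
rewrite psumr_eq0 => [/allP/(_ j)|k _]; last by rewrite !mxE mul_conjC_ge0.
by rewrite mem_index_enum !mxE mul_conjC_eq0 => /(_ isT)/eqP.
Qed.

Lemma cap_line_conj : (A :&: B)%MS = 0.
Proof.
apply/eqP/rowV0P => u; rewrite sub_capmx => /andP[uA uB].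
apply: mulmx_conj_eq0; apply: line_orth => //.
by rewrite -[A](conj_spaceK A) map_submx.
Qed.

Lemma conj_line_K : conj_space B = A. Proof. exact: conj_spaceK. Qed.

Lemma cap_sum_perp : ((A + B) :&: M)%MS = 0.
Proof.
apply/eqP/rowV0P => u; rewrite sub_capmx => /andP[uS uM].
apply: mulmx_conj_eq0; apply: perpP uM _.
case/sub_addsmxP: uS => -[a b] -> /=.
rewrite map_mxD !map_mxM addrC addmx_sub_adds //.
  by rewrite -[X in (_ <= X)%MS]conj_line_K /B /conj_space submxMl.
by rewrite submxMl.
Qed.

Lemma add_sum_perp : ((A + B) + M :=: 1%:M)%MS.
Proof.
apply/eqmxP; rewrite submx1 sub1mx /row_full.
have := mxrank_sum_cap (A + B)%MS M; rewrite cap_sum_perp mxrank0 addn0 => ->.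
rewrite /M /perp /orthomx mul1mx map_mx_id // mxrank_ker mxrank_tr.
by rewrite subnKC ?rank_leq_row ?rank_leq_col ?eqxx // ; exact: rank_leq_row.
Qed.

Definition rproj_line := proj_mx A (M + B)%MS.
Definition rproj_conj := proj_mx B (M + A)%MS.
Definition rproj_perp := proj_mx M (A + B)%MS.

Lemma cap_line_rest : (A :&: (M + B))%MS = 0.
Proof.
apply/eqP/rowV0P => u; rewrite sub_capmx => /andP[uA].
case/sub_addsmxP => -[m b] /= uE.
have mM : (m *m M <= (A + B) :&: M)%MS.
  rewrite sub_capmx submxMl andbT (_ : m *m M = u - b *m B); last by rewrite uE addrK.
  by rewrite addmx_sub_adds // eqmx_opp submxMl.
move: mM; rewrite cap_sum_perp submx0 => /eqP m0.
have : (u <= A :&: B)%MS by rewrite sub_capmx uA uE m0 add0r submxMl.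
by rewrite cap_line_conj submx0 => /eqP.
Qed.

Lemma cap_conj_rest : (B :&: (M + A))%MS = 0.
Proof.
apply/eqP/rowV0P => u; rewrite sub_capmx => /andP[uB].
case/sub_addsmxP => -[m b] /= uE.
have mM : (m *m M <= (A + B) :&: M)%MS.
  rewrite sub_capmx submxMl andbT (_ : m *m M = - (b *m A) + u); last first.
    by rewrite uE addrCA addNr addr0.
  by rewrite addmx_sub_adds // eqmx_opp submxMl.
move: mM; rewrite cap_sum_perp submx0 => /eqP m0.
have : (u <= A :&: B)%MS by rewrite sub_capmx uB uE m0 add0r submxMl.
by rewrite cap_line_conj submx0 => /eqP.
Qed.

Lemma cap_perp_sum : (M :&: (A + B))%MS = 0.
Proof. by rewrite capmxC; exact: cap_sum_perp. Qed.

Variant line_dec_spec m (X : 'M[C]_(m, n)) : Prop :=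
  LineDec a b c of (a <= A)%MS & (b <= B)%MS & (c <= M)%MS & X = b + c + a
   & X *m rproj_line = a & X *m rproj_conj = b & X *m rproj_perp = c.

Lemma line_decP m (X : 'M[C]_(m, n)) : line_dec_spec X.
Proof.
have : (X <= (A + B) + M)%MS by rewrite add_sum_perp submx1.
case/sub_addsmxP => -[s c'] /= XE.
case/sub_addsmxP: (submxMl s (A + B)%MS) => -[a' b'] /= sE.
move: XE; rewrite sE; set a := a' *m A; set b := b' *m B; set c := c' *m M => XE.
have aA : (a <= A)%MS by apply: submxMl.
have bB : (b <= B)%MS by apply: submxMl.
have cM : (c <= M)%MS by apply: submxMl.
apply: (@LineDec _ X a b c) => //.
- by rewrite XE addrC addrCA addrC [c + b]addrC.
- rewrite XE -addrA mulmxDl (proj_mx_id cap_line_rest aA) (proj_mx_0 cap_line_rest) ?addr0 //.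
  by rewrite addrC addmx_sub_adds.
- rewrite XE [a + b]addrC -addrA mulmxDl (proj_mx_id cap_conj_rest bB) (proj_mx_0 cap_conj_rest) ?addr0 //.
  by rewrite addrC addmx_sub_adds.
- rewrite XE mulmxDl (proj_mx_id cap_perp_sum cM) (proj_mx_0 cap_perp_sum) ?add0r //.
  by rewrite addmx_sub_adds.
Qed.

Definition line_scaling (x : C) := x *: rproj_conj + rproj_perp + x^-1 *: rproj_line.

Lemma line_scalingE m (X : 'M[C]_(m, n)) a b c x : (a <= A)%MS -> (b <= B)%MS -> (c <= M)%MS ->
  X = b + c + a -> X *m line_scaling x = x *: b + c + x^-1 *: a.
Proof.
move=> aA bB cM ->; rewrite /line_scaling !mulmxDr !mulmxDl -!scalemxAr.
rewrite (proj_mx_id cap_conj_rest bB) (proj_mx_id cap_perp_sum cM) (proj_mx_id cap_line_rest aA).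
rewrite !(proj_mx_0 cap_conj_rest, proj_mx_0 cap_perp_sum, proj_mx_0 cap_line_rest) ?(addr0, add0r, scaler0) //.
all: by [apply: submx_trans (addsmxSl _ _) | apply: submx_trans (addsmxSr _ _)].
Qed.

Lemma line_scalingM x y : line_scaling x *m line_scaling y = line_scaling (x * y).
Proof.
case: (line_decP 1%:M) => a b c aA bB cM E _ _ _.
rewrite -[line_scaling x]mul1mx (line_scalingE _ aA bB cM E) -[RHS]mul1mx (line_scalingE _ aA bB cM E).
rewrite (line_scalingE (a := x^-1 *: a) (b := x *: b) (c := c)) ?scalemx_sub //.
by rewrite !scalerA [y * x]mulrC -invfM [y * x]mulrC.
Qed.

Lemma line_scaling1 : line_scaling 1 = 1%:M.
Proof.
case: (line_decP 1%:M) => a b c aA bB cM E _ _ _.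
by rewrite -[line_scaling 1]mul1mx (line_scalingE _ aA bB cM E) invr1 !scale1r.
Qed.

Lemma line_scaling_orth x : x != 0 -> line_scaling x *m (line_scaling x)^T = 1%:M.
Proof.
move=> x0; case: (line_decP 1%:M) => a b c aA bB cM E _ _ _.
have K y : y != 0 -> line_scaling y *m (line_scaling y)^T = b *m a^T + c *m c^T + a *m b^T.
  move=> y0; rewrite -[line_scaling y]mul1mx (line_scalingE _ aA bB cM E).
  have -> : (y *: b + c + y^-1 *: a)^T = y *: b^T + c^T + y^-1 *: a^T.
    by rewrite !linearD /= !linearZ.
  have aS : (a <= A + B)%MS by apply: submx_trans aA (addsmxSl _ _).
  have bS : (b <= A + B)%MS by apply: submx_trans bB (addsmxSr _ _).
  have T (U V : 'M[C]_n) : U *m V^T = 0 -> V *m U^T = 0.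
    by move=> UV; rewrite -[V]trmxK -trmx_mul UV trmx0.
  rewrite !mulmxDl !mulmxDr -!scalemxAl -!scalemxAr !scalerA.
  rewrite (line_orth aA aA) (conj_line_orth bB bB) (perpP cM aS) (perpP cM bS).
  rewrite (T _ _ (perpP cM aS)) (T _ _ (perpP cM bS)) mulfV // mulVf // !scale1r.
  by rewrite !(scaler0, addr0, add0r).
by rewrite K // -(K 1) ?oner_eq0 // line_scaling1 trmx1 mulmx1.
Qed.

Lemma det_line_scaling x : x != 0 -> \det (line_scaling x) = 1.
Proof.
move=> x0; rewrite -(sqrtCK x) expr2 -line_scalingM det_mulmx -[X in _ * X]det_tr -det_mulmx line_scaling_orth ?det1 //.
by rewrite sqrtC_eq0.
Qed.

End Line.
End LinearAlgebra.

Arguments isotropic_line C n : clear implicits.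

Section Loops.
Variable R : realType.
Local Notation C := R[i].

Lemma closed1 (a : C) : closed [set (a : C^o)].
Proof.
apply: accessible_closed_set1; apply: hausdorff_accessible; exact: norm_hausdorff.
Qed.

(* CP^1 as the Riemann sphere; None is the point at infinity. *)
Definition sphere : topologicalType := one_point_compactification (C^o).

(* A holomorphic coordinate on the sphere with chart a 0 = a. *)
Definition chart (a : sphere) (z : C) : sphere :=
  if a is Some c then Some (c + z) else if z == 0 then None else Some z^-1.

Variable n : nat.

(* Complex differentiability, the scalar field of C^o being C; a map is
   holomorphic on an open set when this holds at each of its points. *)
Definition cdifferentiable_at (h : C -> 'M[C]_n) (z : C) : Prop :=
  forall i j, derivable (fun w : C^o => h w i j : C^o) z 1.

(* The values of f at its poles are irrelevant. *)
Definition meromorphic (f : sphere -> 'M[C]_n) : Prop :=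
  forall a : sphere, exists (k : nat) (h : C -> 'M[C]_n),
    (\forall z \near (0 : C^o), cdifferentiable_at h z) /\
    (\forall z \near (0 : C^o)^', z ^+ k *: f (chart a z) = h z).

(* The values of eval outside dom are irrelevant. *)
Record loop := Loop {
  dom : set sphere;
  eval :> sphere -> 'M[C]_n;
  dom_open : open dom;
  dom_dense : dense dom;
  eval_holomorphic : forall a, dom a -> cdifferentiable_at (eval \o chart a) 0;
  eval_special_orthogonal : forall a, dom a -> special_orthogonal (eval a) }.

HB.instance Definition _ := gen_eqMixin loop.
HB.instance Definition _ := gen_choiceMixin loop.

Definition agree (g h : loop) : Prop :=
  exists W : set sphere, [/\ open W, dense W, W `<=` dom g `&` dom h &
    forall x, W x -> g x = h x].

Lemma agree_refl g : agree g g.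
Proof. by exists (dom g); split=> //; [apply: dom_open | apply: dom_dense]. Qed.

Lemma agree_sym g h : agree g h -> agree h g.
Proof. by case=> W [oW dW sW eW]; exists W; split=> // x Wx; [case: (sW x Wx) | rewrite eW]. Qed.

Lemma agree_trans h g k : agree g h -> agree h k -> agree g k.
Proof.
move=> [W [oW dW sW eW]] [V [oV dV sV eV]].
exists (W `&` V); split.
- exact: openI.
- exact: denseI.
- by move=> x [/sW[? ?] /sV[? ?]].
- by move=> x [? ?]; rewrite eW ?eV.
Qed.

Lemma agree_equiv : equiv_class_of (fun g h => `[< agree g h >]).
Proof.
split=> [g|g h|h g k].
- exact/asboolP/agree_refl.
- by apply/asbool_equiv_eq; split=> /agree_sym.
- by move=> /asboolP gh /asboolP hk; apply/asboolP; exact: agree_trans gh hk.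
Qed.

Canonical agree_equivrel := EquivRelPack agree_equiv.

Definition loop_group := {eq_quot agree_equivrel}.
HB.instance Definition _ := Choice.on loop_group.
HB.instance Definition _ := EqQuotient.on loop_group.

Lemma piP (g h : loop) : reflect (agree g h) (\pi_loop_group g == \pi_loop_group h).
Proof. by rewrite eqmodE; exact: asboolP. Qed.

Lemma special_orthogonal1 : special_orthogonal (1%:M : 'M[C]_n).
Proof. by apply/special_orthogonalP; rewrite det1 trmx1 mulmx1. Qed.

Lemma special_orthogonalM (A B : 'M[C]_n) : special_orthogonal A -> special_orthogonal B -> special_orthogonal (A *m B).
Proof.
move=> [dA oA] [dB oB]; split; first by rewrite det_mulmx dA dB mulr1.
by move=> u v; rewrite -!mulmxA oA oB.
Qed.

Lemma special_orthogonalV (A : 'M[C]_n) : special_orthogonal A -> special_orthogonal A^T.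
Proof.
move=> /special_orthogonalP[dA oA]; apply/special_orthogonalP; rewrite det_tr trmxK; split=> //.
exact: mulmx1C.
Qed.

Lemma cdifferentiable_atM (f h : C -> 'M[C]_n) z :
  cdifferentiable_at f z -> cdifferentiable_at h z -> cdifferentiable_at (fun w => f w *m h w) z.
Proof.
move=> df dh i j.
rewrite (_ : (fun w : C^o => _) =
  \sum_(k < n) ((fun w : C^o => f w i k : C^o) * (fun w : C^o => h w k j : C^o))).
  by apply: derivable_sum => k; apply: derivableM; [exact: df | exact: dh].
by apply/funext => w; rewrite mxE fct_sumE.
Qed.

Definition loop1 : loop.
Proof.
apply: (@Loop setT (fun=> 1%:M)).
- exact: openT.
- by move=> O O0 _; rewrite setIT.
- by move=> a _ i j; exact: derivable_cst.
- by move=> a _; exact: special_orthogonal1.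
Defined.

Definition loopM (g h : loop) : loop.
Proof.
apply: (@Loop (dom g `&` dom h) (fun x => g x *m h x)).
- by apply: openI; exact: dom_open.
- by apply: denseI; [exact: dom_open | exact: dom_dense | exact: dom_dense].
- by move=> a [ga ha]; apply: cdifferentiable_atM; exact: eval_holomorphic.
- by move=> a [ga ha]; apply: special_orthogonalM; exact: eval_special_orthogonal.
Defined.

Definition loopV (g : loop) : loop.
Proof.
apply: (@Loop (dom g) (fun x => (g x)^T)).
- exact: dom_open.
- exact: dom_dense.
- move=> a ga i j.
  rewrite (_ : (fun w : C^o => _) = (fun w : C^o => (g \o chart a) w j i : C^o)).
    exact: eval_holomorphic.
  by apply/funext => w; rewrite mxE.
- by move=> a ga; apply: special_orthogonalV; exact: eval_special_orthogonal.
Defined.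

Lemma agreeM g g' h h' : agree g g' -> agree h h' -> agree (loopM g h) (loopM g' h').
Proof.
move=> [W [oW dW sW eW]] [V [oV dV sV eV]].
exists (W `&` V); split.
- exact: openI.
- exact: denseI.
- by move=> x [/sW[? ?] /sV[? ?]].
- by move=> x [? ?] /=; rewrite eW ?eV.
Qed.

Lemma agreeV g g' : agree g g' -> agree (loopV g) (loopV g').
Proof. by move=> [W [oW dW sW eW]]; exists W; split=> // x Wx /=; rewrite eW. Qed.

Definition classM (x y : loop_group) : loop_group := \pi_loop_group (loopM (repr x) (repr y)).
Definition classV (x : loop_group) : loop_group := \pi_loop_group (loopV (repr x)).

Lemma agree_repr g : agree (repr (\pi_loop_group g)) g.
Proof. by apply/piP; rewrite reprK. Qed.

Lemma pi_mul g h : classM (\pi_loop_group g) (\pi_loop_group h) = \pi_loop_group (loopM g h).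
Proof. by apply/eqP/piP/agreeM; exact: agree_repr. Qed.

Lemma pi_inv g : classV (\pi_loop_group g) = \pi_loop_group (loopV g).
Proof. by apply/eqP/piP/agreeV/agree_repr. Qed.

Lemma agree_sub g h : dom g `<=` dom h -> (forall x, dom g x -> g x = h x) -> agree g h.
Proof.
by move=> gh e; exists (dom g); split=> //;
  [exact: dom_open | exact: dom_dense | move=> x gx; split=> //; exact: gh].
Qed.

Fact classMA : associative classM.
Proof.
elim/quotW=> f; elim/quotW=> g; elim/quotW=> h.
rewrite (pi_mul g h) (pi_mul f g) (pi_mul f (loopM g h)) (pi_mul (loopM f g) h).
apply/eqP/piP; apply: agree_sub => /= [x [? []]//|].
by move=> x _; rewrite mulmxA.
Qed.

Fact class1M : left_id (\pi_loop_group loop1) classM.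
Proof.
elim/quotW=> f; rewrite (pi_mul loop1 f); apply/eqP/piP; apply: agree_sub => /= [x []//|].
by move=> x _; rewrite mul1mx.
Qed.

Fact classM1 : right_id (\pi_loop_group loop1) classM.
Proof.
elim/quotW=> f; rewrite (pi_mul f loop1); apply/eqP/piP; apply: agree_sub => /= [x []//|].
by move=> x _; rewrite mulmx1.
Qed.

Fact classVM : left_inverse (\pi_loop_group loop1) classV classM.
Proof.
elim/quotW=> f; rewrite (pi_inv f) (pi_mul (loopV f) f); apply/eqP/piP; apply: agree_sub => //=.
by move=> x [/eval_special_orthogonal/special_orthogonalP[]].
Qed.

Fact classMV : right_inverse (\pi_loop_group loop1) classV classM.
Proof.
elim/quotW=> f; rewrite (pi_inv f) (pi_mul f (loopV f)); apply/eqP/piP; apply: agree_sub => //=.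
by move=> x [/eval_special_orthogonal/special_orthogonalP[_ /mulmx1C]].
Qed.

HB.instance Definition _ :=
  isGroup.Build loop_group classMA class1M classM1 classVM classMV.

Definition sphere_conj (x : sphere) : sphere := omap (Num.conj : C -> C) x.

(* For classes of loops, rationality and reality do not depend on the
   representative; being holomorphic at infinity with value 1 means having a
   representative which is defined there with this value. *)
Definition rational (g : loop) : Prop :=
  exists f, meromorphic f /\ forall x, dom g x -> g x = f x.

Definition negative (g : loop) : Prop := dom g None /\ g None = 1%:M.

Definition real_loop (g : loop) : Prop :=
  forall x, dom g x -> dom g (sphere_conj x) ->
    map_mx Num.conj (g (sphere_conj x)) = g x.

Definition loop_group_minus_tau : set loop_group :=
  [set \pi_loop_group g | g in [set g : loop | [/\ rational g, negative g & real_loop g]]].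

Lemma near_neq (z a : C) : z != a -> \forall w \near (z : C^o), w != a.
Proof.
move=> za; have : nbhs (z : C^o) (~` [set (a : C^o)]).
  apply: open_nbhs_nbhs; split; last exact/eqP.
  exact/closed_openC/closed1.
by apply: filterS => w /eqP.
Qed.

Lemma dnear_neq (z a : C) : \forall w \near (z : C^o)^', w != a.
Proof.
have [->|/near_neq za] := eqVneq z a; first exact: nbhs_dnbhs_neq.
by apply: nbhs_dnbhs.
Qed.

Definition off2 (a b : C) : set sphere := [set x | x <> Some a /\ x <> Some b].

Lemma off2_open a b : open (off2 a b).
Proof.
rewrite openE => -[z|] [za zb] /=.
  have {}za : z != a by apply/eqP=> E; apply: za; rewrite E.
  have {}zb : z != b by apply/eqP=> E; apply: zb; rewrite E.
  have : \forall w \near (z : C^o), w != a /\ w != b.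
    by near=> w; split; near: w; exact: near_neq.
  by apply: filterS => w [/eqP wa /eqP wb]; split=> -[].
exists [set a; b].
  split; first by apply: compactU; exact: compact_set1.
  by apply: closedU; exact: closed1.
move=> x [[w /= wab <-]|->//]; split=> -[E]; apply: wab; rewrite E; by [left|right].
Unshelve. all: by end_near.
Qed.

Lemma off2_dense a b : dense (off2 a b).
Proof.
move=> O [[z|] Oz] oO; last by exists None; split.
have Oz' : \forall w \near (z : C^o)^', O (Some w).
  by apply: nbhs_dnbhs; exact: (open_nbhs_nbhs (conj oO Oz)).
have [w [[Ow /eqP wa] /eqP wb]] :=
  filter_ex (filterI (filterI Oz' (dnear_neq z a)) (dnear_neq z b)).
by exists (Some w); split=> //; split=> -[].
Qed.

(* At infinity, where both scalar factors tend to 1, the three projections add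
   up to the identity. *)
Definition simple_mx (alpha : C) (L : isotropic_line C n) (x : sphere) : 'M[C]_n :=
  if x is Some lambda then
    ((lambda - alpha^*) / (lambda - alpha)) *: pi_conj L + pi_mid L
    + ((lambda - alpha) / (lambda - alpha^*)) *: pi_line L
  else 1%:M.

Definition moebius (p q r s w : C) : C := (p + q * w) / (r + s * w).

Lemma derivable_moebius p q r s : r != 0 ->
  derivable (moebius p q r s : C^o -> C^o) 0 1.
Proof.
move=> r0.
have dl a b : derivable (fun w : C^o => a + b * w : C^o) 0 1.
  apply: (@derivableD _ C^o C^o (cst a)); first exact: derivable_cst.
  by apply: derivableZ; exact: derivable_id.
apply: (@derivableM _ C^o (fun w => p + q * w)); first exact: dl.
by apply: (@derivableV _ C^o); [rewrite /= mulr0 addr0 | exact: dl].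
Qed.

Lemma simple_chart alpha L a : off2 alpha alpha^* a -> exists p q r s,
  [/\ p != 0, r != 0 & forall w, simple_mx alpha L (chart a w) =
    moebius p q r s w *: pi_conj L + pi_mid L + moebius r s p q w *: pi_line L].
Proof.
case: a => [c|] [ca cb].
  exists (c - alpha^*), 1, (c - alpha), 1; split.
  - by rewrite subr_eq0; apply/eqP=> E; apply: cb; rewrite E.
  - by rewrite subr_eq0; apply/eqP=> E; apply: ca; rewrite E.
  - by move=> w; rewrite /= /moebius !mul1r ![c + w - _]addrAC.
exists 1, (- alpha^*), 1, (- alpha); split; rewrite ?oner_eq0 // => w.
rewrite /chart /moebius; have [->|w0] := eqVneq w 0.
  rewrite /= !mulr0 addr0 divr1 !scale1r -[LHS]trmx1 -(line_scaling1 L) /line_scaling invr1 !scale1r.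
  by rewrite !linearD.
have E (a b : C) : (w^-1 - a) / (w^-1 - b) = (1 + - a * w) / (1 + - b * w).
  have K c : 1 + - c * w = (w^-1 - c) * w by rewrite mulrBl mulVf // mulNr.
  by rewrite !K -mulf_div divff // mulr1.
by rewrite /= !E.
Qed.

Definition simple_loop (alpha : C) (L : isotropic_line C n) : loop.
Proof.
apply: (@Loop (off2 alpha alpha^*) (simple_mx alpha L)).
- exact: off2_open.
- exact: off2_dense.
- move=> a /(simple_chart L)[p [q [r [s [p0 r0 E]]]]] i j.
  rewrite (_ : (fun w : C^o => _) = (fun w : C^o => pi_conj L i j * moebius p q r s w
     + pi_mid L i j + pi_line L i j * moebius r s p q w)); last first.
    by apply/funext=> w /=; rewrite E !mxE ![_ * moebius _ _ _ _ _]mulrC.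
  apply: (@derivableD _ C^o C^o); last by apply: derivableZ; exact: derivable_moebius.
  apply: (@derivableD _ C^o C^o); last exact: derivable_cst.
  by apply: derivableZ; exact: derivable_moebius.
- move=> [l|] [la lb]; last exact: special_orthogonal1.
  have -> : simple_mx alpha L (Some l) = (line_scaling L ((l - alpha^*) / (l - alpha)))^T.
    by rewrite /= /line_scaling invf_div !linearD /= !linearZ.
  have x0 : (l - alpha^*) / (l - alpha) != 0.
    rewrite mulf_neq0 ?invr_eq0 // subr_eq0; apply/eqP=> E.
      by apply: lb; rewrite E.
    by apply: la; rewrite E.
  apply/special_orthogonalP; rewrite det_tr det_line_scaling // trmxK; split=> //; exact: line_scaling_orth.
Defined.

Definition simple_elements : set loop_group :=
  [set x | exists (alpha : C) (L : isotropic_line C n),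
    alpha \isn't Num.real /\ x = \pi_loop_group (simple_loop alpha L)].

Definition generated (S : set loop_group) : set loop_group :=
  smallest (fun M : set loop_group => group_closed (mem M)) S.

End Loops.

(* Main.v *)
Require Import Defs.
From HB Require Import structures.
From mathcomp Require Import all_boot all_order all_algebra.
From mathcomp Require Import all_classical all_reals.
From mathcomp Require Import topology normedtype derive.
From mathcomp Require Import complex.
From mathcomp Require Import ring lra.

Set Implicit Arguments.
Unset Strict Implicit.
Unset Printing Implicit Defensive.

Import Order.TTheory GRing.Theory Num.Theory.
Import numFieldNormedType.Exports.

Local Open Scope classical_set_scope.
Local Open Scope quotient_scope.
Local Open Scope ring_scope.

(** Every simple element lies in the group because its matrix entries are Moebius
functions of the variable, its value at infinity is the identity, and complex
conjugation exchanges the projections onto L and its conjugate.  All the work is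
in the converse: a rational, negative, real loop g is a product of simple
elements.

The analytic half turns g into algebra: there are a monic polynomial p and a
polynomial matrix N with N = p g, and N - p I has smaller degree than p
([loop_polynomial_form]).  Poles of a meromorphic function on the sphere are
finite in number by compactness, so some p clears them all; the entries of p g
then extend to entire functions which, g being holomorphic at infinity, grow
polynomially, and Liouville's theorem makes them polynomials.  Complex
differentiability is only assumed pointwise, so Liouville's theorem rests on
Goursat's lemma.  Here contour integrals are replaced by midpoint sums along the
sides of a square: these are finite sums, exact on affine functions, and they
satisfy the same additivity under subdivision, which is all that Goursat's
bisection argument uses ([square_sum_cvg0], [liouville]).

The algebraic half removes the poles one root of p at a time.  After
multiplying p and N by the conjugate of p, both are real, and N^T N = p^2 I.
Let alpha be a root of p and N0 = N(alpha).  If N0 = 0, then numerator and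
denominator have a common factor, and the degree of p drops ([divide_root]).
Otherwise alpha is not real, since a real matrix with N0^T N0 = 0 vanishes.  The
relation N0^T N0 = 0 says that the image of N0 is isotropic; take for L a line
v in this image.  The product p_{alpha,L} N is again polynomial: the pole of
p_{alpha,L} at alpha has residue proportional to (conj v) v^T, and v^T N0 = 0;
the pole at the conjugate of alpha is treated by reality.  The first order
term of N^T N = p^2 I at alpha shows that the new value at alpha is K N0 for
some matrix K, and that it kills a vector which N0 maps to v; hence its rank is
smaller ([reduce_rank]).  After finitely many factors N(alpha) = 0.  When p has
no root left, p = 1, and the degree bound gives N = I. *)

(** * Bisection of squares *)

Section SquareBisection.
Variable R : realType.

Lemma nested_intervals (X s : nat -> R) :
  (forall n, X n <= X n.+1) -> (forall n, X n.+1 + s n.+1 <= X n + s n) ->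
  (forall n, 0 <= s n) -> exists a, forall n, X n <= a <= X n + s n.
Proof.
move=> X_incr Y_decr s_ge0.
have Xle m k : X m <= X (m + k)%N.
  by elim: k => [|k IH]; rewrite ?addn0 // addnS (le_trans IH).
have Yle m k : X (m + k)%N + s (m + k)%N <= X m + s m.
  by elim: k => [|k IH]; rewrite ?addn0 // addnS (le_trans _ IH).
have XY m k : X m <= X k + s k.
  apply: le_trans (Xle m k) _; rewrite addnC.
  by apply: le_trans (Yle k m); rewrite lerDl.
have X0 : range X !=set0 by exists (X 0%N); exists 0%N.
have ubX : has_ubound (range X) by exists (X 0%N + s 0%N) => _ [m _ <-].
exists (sup (range X)) => n; apply/andP; split.
  by apply: ub_le_sup => //; exists n.
by apply: ge_sup => // _ [m _ <-].
Qed.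

Lemma small_halves (s d : R) : 0 < s -> 0 < d -> exists n, s / 2 ^+ n < d.
Proof.
move=> s0 d0; have sd0 : 0 <= s / d by rewrite divr_ge0 // ltW.
exists (Num.bound (s / d)); rewrite ltr_pdivrMr ?exprn_gt0 // mulrC.
rewrite -ltr_pdivrMr //; apply: lt_le_trans (archi_boundP sd0) _.
by rewrite -natrX ler_nat ltnW // ltn_expl.
Qed.

(** Compactness of a closed square in the form used by Goursat: if B fails on a
square, it fails on one of the four quarters, and the nested squares so obtained
shrink to a point, around which B holds by assumption. *)
Lemma square_bisection (B : R -> R -> R -> Prop) :
  (forall x y s, 0 < s -> B x y (s / 2) -> B (x + s / 2) y (s / 2) ->
    B x (y + s / 2) (s / 2) -> B (x + s / 2) (y + s / 2) (s / 2) -> B x y s) ->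
  (forall a b, exists2 d, 0 < d & forall x y s, 0 < s < d ->
    x <= a <= x + s -> y <= b <= y + s -> B x y s) ->
  forall x y s, 0 < s -> B x y s.
Proof.
move=> split_B local_B x y s s0; apply: contrapT => nB.
pose next (q : R * R * R) : R * R * R := let: (x, y, s) := q in
  let h := s / 2 in
  if ~~ `[< B x y h >] then (x, y, h) else
  if ~~ `[< B (x + h) y h >] then (x + h, y, h) else
  if ~~ `[< B x (y + h) h >] then (x, y + h, h) else (x + h, y + h, h).
pose Q n := iter n next (x, y, s).
pose X n := (Q n).1.1; pose Y n := (Q n).1.2; pose S n := (Q n).2.
have SE n : S n = s / 2 ^+ n.
  rewrite /S; elim: n => [|n]; first by rewrite /= divr1.
  rewrite /Q iterS -/(Q n); case: (Q n) => -[a b] c /= ->.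
  by do ![case: ifP => _ //=]; rewrite exprSr invfM mulrA.
have S_gt0 n : 0 < S n by rewrite SE divr_gt0 // exprn_gt0.
have bad n : ~ B (X n) (Y n) (S n).
  elim: n => [|n]; first exact: nB.
  move: (S_gt0 n); rewrite /X /Y /S /Q iterS -/(Q n); case: (Q n) => -[a b] c /= c0 nBn.
  case: ifPn => [/asboolPn//|/negPn/asboolP B1].
  case: ifPn => [/asboolPn//|/negPn/asboolP B2].
  case: ifPn => [/asboolPn//|/negPn/asboolP B3] B4.
  by apply: nBn; exact: split_B.
have nextP n : [/\ X n <= X n.+1, X n.+1 + S n.+1 <= X n + S n,
    Y n <= Y n.+1 & Y n.+1 + S n.+1 <= Y n + S n].
  move: (S_gt0 n); rewrite /X /Y /S /Q iterS -/(Q n); case: (Q n) => -[a b] c /= c0.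
  by do ![case: ifP => _ /=]; split; lra.
have [a aP] : exists a, forall n, X n <= a <= X n + S n.
  by apply: nested_intervals => n; [case: (nextP n)|case: (nextP n)|exact: ltW].
have [b bP] : exists b, forall n, Y n <= b <= Y n + S n.
  by apply: nested_intervals => n; [case: (nextP n)|case: (nextP n)|exact: ltW].
have [d d0 Bd] := local_B a b.
have [n nd] := small_halves s0 d0.
by apply: (bad n); apply: Bd => //; rewrite S_gt0 SE.
Qed.

End SquareBisection.

(** * The real-valued modulus *)

Section Modulus.
Local Open Scope complex_scope.
Variable R : realType.
Local Notation C := R[i].
Implicit Types (x y z w : C).

(** The norm of R[i] takes its values in R[i], whose order is partial;
estimates are carried out in the ordered field R instead. *)
Definition modulus z : R := ComplexField.Normc.normc z.

Arguments modulus : simpl never.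

Lemma normE z : `|z| = (modulus z)%:C. Proof. by []. Qed.

Lemma modulus_ge0 z : 0 <= modulus z.
Proof. by case: z => a b; exact: sqrtr_ge0. Qed.

Lemma modulusM z w : modulus (z * w) = modulus z * modulus w.
Proof. exact: ComplexField.Normc.normcM. Qed.

Lemma modulusV z : modulus z^-1 = (modulus z)^-1.
Proof. exact: ComplexField.Normc.normcV. Qed.

Lemma modulusN z : modulus (- z) = modulus z.
Proof. by apply: complexI; rewrite -!normE normrN. Qed.

Lemma modulusX z n : modulus (z ^+ n) = modulus z ^+ n.
Proof. by apply: complexI; rewrite rmorphXn -!normE normrX. Qed.

Lemma modulus0 : modulus 0 = 0.
Proof. exact: ComplexField.Normc.normc0. Qed.

Lemma modulusR (r : R) : modulus r%:C = `|r|.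
Proof. by rewrite /modulus /ComplexField.Normc.normc /= expr0n /= addr0 sqrtr_sqr. Qed.

Lemma modulusI (r : R) : modulus (0 +i* r) = `|r|.
Proof. by rewrite /modulus /ComplexField.Normc.normc /= expr0n /= add0r sqrtr_sqr. Qed.

Lemma modulus_eq0 z : (modulus z == 0) = (z == 0).
Proof. by rewrite -(inj_eq (@complexI R)) -normE normr_eq0. Qed.

Lemma modulus_gt0 z : (0 < modulus z) = (z != 0).
Proof. by rewrite lt_def modulus_ge0 andbT modulus_eq0. Qed.

Lemma modulusD z w : modulus (z + w) <= modulus z + modulus w.
Proof. by rewrite -lecR rmorphD -!normE ler_normD. Qed.

Lemma modulusB z w : modulus (z - w) <= modulus z + modulus w.
Proof. by rewrite -(modulusN w) modulusD. Qed.

Lemma modulus_distC z w : modulus (z - w) = modulus (w - z).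
Proof. by rewrite -modulusN opprB. Qed.

Lemma lerB_modulus z w : modulus z - modulus w <= modulus (z - w).
Proof. by rewrite lerBlDr -{1}(subrK w z) modulusD. Qed.

Lemma modulus_le_ReIm z : modulus z <= `|complex.Re z| + `|complex.Im z|.
Proof.
case: z => a b /=; rewrite -modulusR -modulusI.
have -> : a +i* b = a%:C + 0 +i* b by rewrite /real_complex_def; simpc.
exact: modulusD.
Qed.

Lemma Re_le_modulus z : `|complex.Re z| <= modulus z.
Proof. by rewrite -lecR -normE normc_ge_Re. Qed.

Lemma Im_le_modulus z : `|complex.Im z| <= modulus z.
Proof.
case: z => a b; rewrite -sqrtr_sqr ler_wsqrtr // lerDr sqr_ge0 //.
Qed.

Lemma ReD z w : complex.Re (z + w) = complex.Re z + complex.Re w.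
Proof. by case: z w => ? ? []. Qed.
Lemma ImD z w : complex.Im (z + w) = complex.Im z + complex.Im w.
Proof. by case: z w => ? ? []. Qed.
Lemma ReN z : complex.Re (- z) = - complex.Re z.
Proof. by case: z. Qed.
Lemma ImN z : complex.Im (- z) = - complex.Im z.
Proof. by case: z. Qed.

End Modulus.
Arguments modulus : simpl never.

Section EpsilonDelta.
Local Open Scope complex_scope.
Variable R : realType.
Local Notation C := R[i].
Implicit Types (z w c : C) (f : C -> C).

Lemma near_modulusP c (P : C -> Prop) :
  (\forall w \near (c : C^o), P w) <->
  exists2 d : R, 0 < d & forall w, modulus (w - c) < d -> P w.
Proof.
split=> [/nbhs_ballP[[d d'] /=]|[d d0 dP]].
  rewrite ltcE /= => /andP[/eqP -> d0] dP; exists d => // w wc; apply: dP.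
  by rewrite /ball /= distrC normE ltcR.
apply/nbhs_ballP; exists d%:C; first by rewrite /= ltcR.
by move=> w; rewrite /ball /= distrC normE ltcR => /dP.
Qed.

Lemma dnear_modulusP c (P : C -> Prop) :
  (\forall w \near (c : C^o)^', P w) <->
  exists2 d : R, 0 < d & forall w, modulus (w - c) < d -> w != c -> P w.
Proof. exact: near_modulusP. Qed.

Lemma continuous_modulus f c (e : R) : {for c, continuous (f : C^o -> C^o)} -> 0 < e ->
  exists2 d : R, 0 < d & forall w, modulus (w - c) < d -> modulus (f w - f c) <= e.
Proof.
move=> /cvgr_distC_le fc e0; apply/near_modulusP.
have := fc e%:C; rewrite ltcR => /(_ e0); apply: filterS => w.
by rewrite normE lecR.
Qed.

Lemma derivable_modulus f c : derivable (f : C^o -> C^o) c 1 ->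
  exists l : C, forall e : R, 0 < e -> exists2 d : R, 0 < d &
    forall w, modulus (w - c) < d ->
      modulus (f w - f c - l * (w - c)) <= e * modulus (w - c).
Proof.
move=> /cvg_ex[l /cvgr_distC_le fl]; exists l => e e0.
have := fl e%:C; rewrite ltcR => /(_ e0) /dnear_modulusP[d d0 dP].
exists d => // w wc; have [->|wnc] := eqVneq w c.
  by rewrite !subrr mulr0 subrr modulus0 mulr0.
have h0 : w - c != 0 by rewrite subr_eq0.
have := dP (w - c); rewrite subr0 => /(_ wc h0).
rewrite /= normE lecR /GRing.scale /= mulr1 subrK => wle.
have -> : f w - f c - l * (w - c) = ((w - c)^-1 * (f w - f c) - l) * (w - c).
  by rewrite mulrBl mulrAC mulVf // mul1r.
by rewrite modulusM ler_wpM2r ?modulus_ge0.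
Qed.

End EpsilonDelta.

(** * Midpoint sums along the sides of a square *)

Section EdgeSums.
Local Open Scope complex_scope.
Variable R : realType.
Local Notation C := R[i].
Implicit Types (f g : C -> C) (z d w : C).

(** The midpoint rule for the integral of f along the segment from z to z + d, cut
into 2^m equal parts.  Halving the segment lowers m by one, so that sums along
edges are additive under subdivision. *)
Fixpoint edge_sum m f z d : C :=
  if m is m'.+1 then edge_sum m' f z (d / 2) + edge_sum m' f (z + d / 2) (d / 2)
  else f (z + d / 2) * d.

Definition on_segment z d w := exists2 t : R, 0 <= t <= 1 & w = z + t%:C * d.

Lemma on_segment_mid z d : on_segment z d (z + d / 2).
Proof.
exists 2^-1; first lra.
by congr (_ + _); rewrite mulrC fmorphV /= rmorph_nat.
Qed.

Lemma on_segment_l z d w : on_segment z (d / 2) w -> on_segment z d w.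
Proof.
case=> t t01 ->; exists (t / 2); first lra.
by rewrite rmorphM fmorphV /= rmorph_nat; ring.
Qed.

Lemma on_segment_r z d w : on_segment (z + d / 2) (d / 2) w -> on_segment z d w.
Proof.
case=> t t01 ->; exists ((1 + t) / 2); first lra.
by rewrite rmorphM fmorphV rmorphD /= rmorph_nat rmorph1; field.
Qed.

Lemma edge_sum_ext m f g z d : (forall w, on_segment z d w -> f w = g w) ->
  edge_sum m f z d = edge_sum m g z d.
Proof.
elim: m z d => [|m IH] z d fg /=; first by rewrite fg //; exact: on_segment_mid.
by rewrite !IH // => w sw; apply: fg; [exact: on_segment_r|exact: on_segment_l].
Qed.

Lemma edge_sumD m f g z d :
  edge_sum m (fun w => f w + g w) z d = edge_sum m f z d + edge_sum m g z d.
Proof. by elim: m z d => [|m IH] z d /=; rewrite ?IH; ring. Qed.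

Lemma edge_sumZ m a f z d :
  edge_sum m (fun w => a * f w) z d = a * edge_sum m f z d.
Proof. by elim: m z d => [|m IH] z d /=; rewrite ?IH; ring. Qed.

(** The midpoint rule is exact on polynomials of degree at most 1; the right-hand
side is the increment of the primitive. *)
Lemma edge_sum_affine m a b z d :
  edge_sum m (fun w => a + b * w) z d = a * d + b * ((z + d) ^+ 2 - z ^+ 2) / 2.
Proof. by elim: m z d => [|m IH] z d /=; rewrite ?IH; field. Qed.

Lemma edge_sum_le m f z d M : (forall w, on_segment z d w -> modulus (f w) <= M) ->
  modulus (edge_sum m f z d) <= M * modulus d.
Proof.
elim: m z d => [|m IH] z d fM /=.
  by rewrite modulusM ler_wpM2r ?modulus_ge0 //; apply: fM; exact: on_segment_mid.
apply: le_trans (modulusD _ _) _.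
have -> : modulus d = modulus (d / 2) + modulus (d / 2).
  by rewrite modulusM modulusV -[2]/(2%:R) -(rmorph_nat (real_complex R)) modulusR ger0_norm //; field.
rewrite mulrDr; apply: lerD; apply: IH => w sw; apply: fM.
  exact: on_segment_l.
exact: on_segment_r.
Qed.

Lemma edge_sum_Im m f z d k :
  (forall w, on_segment z d w -> k <= complex.Im (f w * d)) ->
  k <= complex.Im (edge_sum m f z d).
Proof.
elim: m z d k => [|m IH] z d k fk /=; first by apply: fk; exact: on_segment_mid.
have H w : on_segment z d w -> k / 2 <= complex.Im (f w * (d / 2)).
  move=> /fk; have -> : f w * d = f w * (d / 2) + f w * (d / 2) by field.
  by rewrite ImD; move: (complex.Im _) => x; lra.
rewrite ImD (_ : k = k / 2 + k / 2); last by field.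
by apply: lerD; apply: IH => w sw; apply: H; [exact: on_segment_l|exact: on_segment_r].
Qed.

(** The discrete analogue of the integral of f along the boundary, run
counterclockwise, of the square of side s with lower left corner x + i y. *)
Definition square_sum m f (x y s : R) : C :=
  edge_sum m f (x +i* y) s%:C + edge_sum m f ((x + s) +i* y) (0 +i* s)
  - edge_sum m f (x +i* (y + s)) s%:C - edge_sum m f (x +i* y) (0 +i* s).

Definition on_square (x y s : R) w := [\/ on_segment (x +i* y) s%:C w,
  on_segment ((x + s) +i* y) (0 +i* s) w, on_segment (x +i* (y + s)) s%:C w |
  on_segment (x +i* y) (0 +i* s) w].

Lemma on_squareP x y s w : 0 <= s -> on_square x y s w ->
  [/\ x <= complex.Re w <= x + s, y <= complex.Im w <= y + s &
    (complex.Re w = x \/ complex.Re w = x + s) \/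
    (complex.Im w = y \/ complex.Im w = y + s)].
Proof.
move=> s0 [] [t t01 ->] /=; rewrite ?(mul0r, mulr0, addr0, add0r, subr0).
all: have ts : 0 <= t * s <= s by apply/andP; split; nra.
all: split; [lra|lra|tauto].
Qed.

(** Each inner edge belongs to two quarters, with opposite orientations. *)
Lemma square_sum_split m f x y s : square_sum m.+1 f x y s =
  square_sum m f x y (s / 2) + square_sum m f (x + s / 2) y (s / 2)
  + square_sum m f x (y + s / 2) (s / 2)
  + square_sum m f (x + s / 2) (y + s / 2) (s / 2).
Proof.
rewrite /square_sum /=.
have e1 : s%:C / 2 = (s / 2)%:C :> C by rewrite rmorphM fmorphV /= rmorph_nat.
have e2 : (0 +i* s) / 2 = 0 +i* (s / 2) :> C.
  have I r : 0 +i* r = 'i * r%:C :> C by rewrite /real_complex_def; simpc.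
  by rewrite !I -mulrA e1.
have aC a b c : (a +i* b) + c%:C = (a + c) +i* b :> C by rewrite /real_complex_def; simpc.
have aI a b c : (a +i* b) + (0 +i* c) = a +i* (b + c) :> C by simpc.
rewrite !(e1, e2) !(aC, aI).
have -> : x + s / 2 + s / 2 = x + s by field.
have -> : y + s / 2 + s / 2 = y + s by field.
ring.
Qed.

Lemma square_sum_ext m f g x y s : (forall w, on_square x y s w -> f w = g w) ->
  square_sum m f x y s = square_sum m g x y s.
Proof.
move=> fg; rewrite /square_sum; congr (_ + _ - _ - _); apply: edge_sum_ext => w sw; apply: fg.
- exact: Or41.
- exact: Or42.
- exact: Or43.
- exact: Or44.
Qed.

Lemma square_sumD m f g x y s : square_sum m (fun w => f w + g w) x y s =
  square_sum m f x y s + square_sum m g x y s.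
Proof. by rewrite /square_sum !edge_sumD; ring. Qed.

Lemma square_sumZ m a f x y s :
  square_sum m (fun w => a * f w) x y s = a * square_sum m f x y s.
Proof. by rewrite /square_sum !edge_sumZ; ring. Qed.

(** The exact sums of an affine function telescope along the closed contour. *)
Lemma square_sum_affine m a b x y s : square_sum m (fun w => a + b * w) x y s = 0.
Proof.
rewrite /square_sum !edge_sum_affine.
have I p q : p +i* q = p%:C + 'i * q%:C :> C by rewrite /real_complex_def; simpc.
by rewrite !I !rmorphD; field.
Qed.

Lemma square_sum_le m f x y s M : 0 <= s ->
  (forall w, on_square x y s w -> modulus (f w) <= M) ->
  modulus (square_sum m f x y s) <= 4 * (M * s).
Proof.
move=> s0 fM; have sC : modulus (s%:C : C) = s by rewrite modulusR ger0_norm.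
have sI : modulus (0 +i* s : C) = s by rewrite modulusI ger0_norm.
have H1 := @edge_sum_le m f (x +i* y) s%:C M (fun w sw => fM w (Or41 _ _ _ sw)).
have H2 := @edge_sum_le m f ((x + s) +i* y) (0 +i* s) M (fun w sw => fM w (Or42 _ _ _ sw)).
have H3 := @edge_sum_le m f (x +i* (y + s)) s%:C M (fun w sw => fM w (Or43 _ _ _ sw)).
have H4 := @edge_sum_le m f (x +i* y) (0 +i* s) M (fun w sw => fM w (Or44 _ _ _ sw)).
rewrite sC in H1 H3; rewrite sI in H2 H4.
rewrite /square_sum; apply: le_trans (modulusB _ _) _.
have := modulusB (edge_sum m f (x +i* y) s%:C + edge_sum m f ((x + s) +i* y) (0 +i* s))
  (edge_sum m f (x +i* (y + s)) s%:C).
have := modulusD (edge_sum m f (x +i* y) s%:C) (edge_sum m f ((x + s) +i* y) (0 +i* s)).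
lra.
Qed.

End EdgeSums.

(** * Goursat's lemma with exceptional points *)

Section Goursat.
Local Open Scope complex_scope.
Variable R : realType.
Local Notation C := R[i].

(** An increasing function whose increment over an interval of length s around 0
is at least the square root of s. *)
Definition signed_sqrt (t : R) := Num.sg t * Num.sqrt `|t|.

Lemma signed_sqrtN t : signed_sqrt (- t) = - signed_sqrt t.
Proof. by rewrite /signed_sqrt sgrN normrN mulNr. Qed.

Lemma signed_sqrt_ge0 t : 0 <= t -> signed_sqrt t = Num.sqrt t.
Proof.
rewrite /signed_sqrt le_eqVlt => /predU1P[<-|t0]; first by rewrite normr0 sqrtr0 mulr0.
by rewrite gtr0_sg // gtr0_norm // mul1r.
Qed.

Lemma signed_sqrt_le t u : t <= u -> signed_sqrt t <= signed_sqrt u.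
Proof.
move=> tu; have [t0|t0] := lerP 0 t.
  by rewrite !signed_sqrt_ge0 ?ler_wsqrtr // (le_trans t0).
have nt : 0 <= - t by lra.
have [u0|u0] := lerP 0 u.
  rewrite -[t]opprK signed_sqrtN (signed_sqrt_ge0 u0) (signed_sqrt_ge0 nt).
  by apply: (@le_trans _ _ 0); rewrite ?sqrtr_ge0 // oppr_le0 sqrtr_ge0.
have nu : 0 <= - u by lra.
rewrite -[t]opprK -[u]opprK ![signed_sqrt (- - _)]signed_sqrtN lerN2.
by rewrite !signed_sqrt_ge0 // ler_wsqrtr // lerN2.
Qed.

Lemma sqrt_le_signed_sqrtB t s : t <= 0 <= t + s ->
  Num.sqrt s <= signed_sqrt (t + s) - signed_sqrt t.
Proof.
move=> /andP[t0 ts0]; have nt : 0 <= - t by lra.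
rewrite -signed_sqrtN !signed_sqrt_ge0 //.
have s0 : 0 <= s by lra.
rewrite -(@ler_pXn2r _ 2) ?nnegrE ?addr_ge0 ?sqrtr_ge0 //.
rewrite sqrrD !sqr_sqrtr // -[leLHS](addrK t) [s + t]addrC -addrA [leRHS]addrAC.
have := mulr_ge0 (sqrtr_ge0 (t + s)) (sqrtr_ge0 (- t)).
by rewrite mulr2n; lra.
Qed.

(** A product measure of the square, concentrated near c: it is additive under
subdivision, and at least s when c lies in the square, although the area is
only s^2. *)
Definition point_weight (c : C) (x y s : R) : R :=
  (signed_sqrt (x + s - complex.Re c) - signed_sqrt (x - complex.Re c)) *
  (signed_sqrt (y + s - complex.Im c) - signed_sqrt (y - complex.Im c)).

Definition square_weight (S : seq C) (x y s : R) : R :=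
  s ^+ 2 + \sum_(c <- S) point_weight c x y s.

Lemma point_weight_ge0 c x y s : 0 <= s -> 0 <= point_weight c x y s.
Proof. by move=> s0; apply: mulr_ge0; rewrite subr_ge0 signed_sqrt_le //; lra. Qed.

Lemma point_weight_ge c x y s : 0 <= s -> x <= complex.Re c <= x + s ->
  y <= complex.Im c <= y + s -> s <= point_weight c x y s.
Proof.
move=> s0 xc yc; rewrite -{1}(sqr_sqrtr s0) expr2.
apply: ler_pM; rewrite ?sqrtr_ge0 //.
  by rewrite [x + s - _]addrAC sqrt_le_signed_sqrtB //; lra.
by rewrite [y + s - _]addrAC sqrt_le_signed_sqrtB //; lra.
Qed.

Lemma square_weight_ge0 S x y s : 0 <= s -> 0 <= square_weight S x y s.
Proof.
by move=> s0; rewrite addr_ge0 ?sqr_ge0 // sumr_ge0 // => c _; exact: point_weight_ge0.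
Qed.

Lemma square_weight_split S x y s : square_weight S x y s =
  square_weight S x y (s / 2) + square_weight S (x + s / 2) y (s / 2)
  + square_weight S x (y + s / 2) (s / 2)
  + square_weight S (x + s / 2) (y + s / 2) (s / 2).
Proof.
rewrite /square_weight.
have -> : \sum_(c <- S) point_weight c x y s =
   \sum_(c <- S) point_weight c x y (s / 2) +
   \sum_(c <- S) point_weight c (x + s / 2) y (s / 2) +
   \sum_(c <- S) point_weight c x (y + s / 2) (s / 2) +
   \sum_(c <- S) point_weight c (x + s / 2) (y + s / 2) (s / 2).
  rewrite -!big_split /=; apply: eq_bigr => c _; rewrite /point_weight.
  have -> : x + s / 2 + s / 2 = x + s by field.
  have -> : y + s / 2 + s / 2 = y + s by field.
  by ring.
by field.
Qed.

(** Goursat's argument, with the area replaced by [square_weight]; the bound is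
additive under subdivision, so it has to be checked on small squares only.
Around a point of differentiability f is affine up to an error e s, which
contributes e s^2 along a perimeter of order s.  Around a point of S, f is only
constant up to e, which contributes e s; this is paid for by the weight of that
point. *)
Theorem square_sum_cvg0 (S : seq C) (f : C -> C) :
  (forall z, {for z, continuous (f : C^o -> C^o)}) ->
  (forall z, z \notin S -> derivable (f : C^o -> C^o) z 1) ->
  forall e, 0 < e -> forall x y s, 0 < s -> exists m0, forall m, (m0 <= m)%N ->
    modulus (square_sum m f x y s) <= e * square_weight S x y s.
Proof.
move=> f_cont f_der e e0; apply: square_bisection => [x y s s0|a b].
  move=> [m1 H1] [m2 H2] [m3 H3] [m4 H4].
  exists (maxn (maxn m1 m2) (maxn m3 m4)).+1 => -[//|m]; rewrite ltnS !geq_max.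
  case/andP=> /andP[/H1 {}H1 /H2 {}H2] /andP[/H3 {}H3 /H4 {}H4].
  rewrite square_sum_split square_weight_split 3!mulrDr.
  apply: le_trans (modulusD _ _) _; apply: lerD => //.
  apply: le_trans (modulusD _ _) _; apply: lerD => //.
  by apply: le_trans (modulusD _ _) _; apply: lerD.
pose c := a +i* b.
(* Both coordinates of w - c are at most s in absolute value. *)
have close x y s w : 0 < s -> x <= a <= x + s -> y <= b <= y + s ->
    on_square x y s w -> modulus (w - c) <= 2 * s.
  move=> s0 xa yb /(on_squareP (ltW s0))[xw yw _].
  apply: le_trans (modulus_le_ReIm _) _; rewrite ReD ImD ReN ImN /=.
  by rewrite (_ : 2 * s = s + s); [apply: lerD; rewrite ler_norml; lra|ring].
have [cS|cS] := boolP (c \in S).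
  have e4 : 0 < e / 4 by lra.
  have [d d0 dP] := continuous_modulus (f_cont c) e4.
  exists (d / 2); first lra.
  move=> x y s /andP[s0 sd] xa yb; exists 0%N => m _.
  have -> : square_sum m f x y s = square_sum m (fun w => f w - f c) x y s.
    rewrite [RHS](@square_sum_ext _ _ _ (fun w => f w + (- f c + 0 * w))).
      by rewrite square_sumD square_sum_affine addr0.
    by move=> w _; rewrite mul0r addr0.
  apply: le_trans (@square_sum_le _ _ _ _ _ _ (e / 4) (ltW s0) _) _.
    by move=> w /(close _ _ _ _ s0 xa yb) wc; apply: dP; lra.
  rewrite mulrA [4 * _](_ : _ = e); last by field.
  rewrite ler_pM2l // /square_weight (big_rem c) //=.
  have := @point_weight_ge c x y s (ltW s0) xa yb.
  have : 0 <= \sum_(z <- rem c S) point_weight z x y s.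
    by apply: sumr_ge0 => z _; rewrite point_weight_ge0 // ltW.
  by have := sqr_ge0 s; lra.
have [l lP] := derivable_modulus (f_der _ cS).
have e8 : 0 < e / 8 by lra.
have [d d0 dP] := lP _ e8.
exists (d / 2); first lra.
move=> x y s /andP[s0 sd] xa yb; exists 0%N => m _.
have -> : square_sum m f x y s = square_sum m (fun w => f w - f c - l * (w - c)) x y s.
  rewrite [RHS](@square_sum_ext _ _ _ (fun w => f w + ((l * c - f c) + (- l) * w))).
    by rewrite square_sumD square_sum_affine addr0.
  by move=> w _; ring.
apply: le_trans (@square_sum_le _ _ _ _ _ _ (e / 8 * (2 * s)) (ltW s0) _) _.
  move=> w /(close _ _ _ _ s0 xa yb) wc; apply: le_trans (dP _ _) _; first by lra.
  by rewrite ler_pM2l.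
have -> : 4 * (e / 8 * (2 * s) * s) = e * s ^+ 2 by field.
rewrite ler_pM2l // /square_weight lerDl.
by apply: sumr_ge0 => z _; rewrite point_weight_ge0 // ltW.
Qed.

End Goursat.

(** * Liouville's theorem *)

Section Liouville.
Local Open Scope complex_scope.
Variable R : realType.
Local Notation C := R[i].

Lemma continuous_modulusP (f : C -> C) c :
  (forall e : R, 0 < e -> exists2 d : R, 0 < d &
    forall w, modulus (w - c) < d -> modulus (f w - f c) <= e) ->
  {for c, continuous (f : C^o -> C^o)}.
Proof.
move=> fP; apply/(@cvgrPdistC_le C C^o C^o (nbhs (c : C^o)) _ f (f c)) => e; rewrite ltcE /= => /andP[/eqP e_re e0].
have [d d0 dP] := fP _ e0; apply/near_modulusP; exists d => // w /dP.
by rewrite normE -lecR; case: e e_re {e0 fP dP} => a b /= ->.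
Qed.

Lemma dnear_notin (S : seq C) (c : C) : \forall w \near (c : C^o)^', w \notin S.
Proof.
elim: S => [|a S IH]; first by near=> w.
near=> w; rewrite inE negb_or; apply/andP; split; first by near: w; exact: dnear_neq.
by near: w.
Unshelve. all: by end_near. Qed.

Lemma exists_notin (S : seq C) : exists a, a \notin S.
Proof.
by have [a aS] := @filter_ex C^o ((0 : C^o)^') _ _ (dnear_notin S 0); exists a.
Qed.

(** Differentiability of the quotient at a would be the theorem on removable
singularities; it is avoided by allowing, in [square_sum_cvg0], exceptional points
at which the function is only continuous. *)
Lemma difference_quotient (f : C -> C) a :
  (forall z, {for z, continuous (f : C^o -> C^o)}) ->
  derivable (f : C^o -> C^o) a 1 ->
  exists g : C -> C, [/\ forall z, f z = f a + (z - a) * g z,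
    forall z, {for z, continuous (g : C^o -> C^o)} &
    forall z, z != a -> derivable (f : C^o -> C^o) z 1 -> derivable (g : C^o -> C^o) z 1].
Proof.
move=> f_cont /derivable_modulus[l lP].
pose g z := if z == a then l else (f z - f a) / (z - a).
have near_g z : z != a -> \forall w \near (z : C^o), (w - a)^-1 * (f w - f a) = g w.
  move=> /near_neq; apply: filterS => w wa.
  by rewrite /g (negPf wa) mulrC.
exists g; split=> [z|z|z za dz].
- rewrite /g; case: eqVneq => [->|za]; first by rewrite subrr mul0r addr0.
  by rewrite mulrC divfK ?subr_eq0 // addrCA subrr addr0.
- have [->|za] := eqVneq z a; last first.
    have H : {for z, continuous (fun w : C^o => (w - a)^-1 * (f w - f a) : C^o)}.
      apply: (@continuousM _ C^o (fun w => (w - a)^-1) (fun w => f w - f a)).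
        apply: (@continuousV _ C^o); first by rewrite subr_eq0.
        by apply: continuousB; [exact: (@cvg_id C^o)|exact: cst_continuous].
      by apply: continuousB; [exact: f_cont|exact: cst_continuous].
    rewrite /prop_for /continuous_at -(nbhs_singleton (near_g z za)).
    by apply: cvg_trans H; exact: (@near_eq_cvg C^o C^o (nbhs (z : C^o)) _ _ g (near_g z za)).
  apply: continuous_modulusP => e e0; have [d d0 dP] := lP _ e0; exists d => // w wa.
  rewrite {2}/g eqxx /g; case: eqVneq => [_|wna].
    by rewrite subrr modulus0 ltW.
  have -> : (f w - f a) / (w - a) - l = (f w - f a - l * (w - a)) / (w - a).
    by rewrite [RHS]mulrBl mulfK // subr_eq0.
  rewrite modulusM modulusV ler_pdivrMr ?modulus_gt0 ?subr_eq0 //.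
  exact: dP.
apply: near_eq_derivable (near_g z za) _.
apply: (@derivableM _ C^o (fun w => (w - a)^-1) (fun w => f w - f a)).
  apply: (@derivableV _ C^o); first by rewrite subr_eq0.
  by apply: derivableB; [exact: derivable_id|exact: derivable_cst].
by apply: derivableB; [exact: dz|exact: derivable_cst].
Qed.

Lemma Im_invM (a b u v : R) :
  complex.Im ((a +i* b)^-1 * (u +i* v)) = (a * v - b * u) / (a ^+ 2 + b ^+ 2).
Proof.
have -> : (a +i* b)^-1 = (a / (a ^+ 2 + b ^+ 2)) +i* (- (b / (a ^+ 2 + b ^+ 2))) by [].
by rewrite /=; ring.
Qed.

(** A lower bound, uniform in m and in the size of the square, for the discrete
version of the winding number integral 2 i pi. *)
Lemma square_sum_inv m (T : R) : 0 < T ->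
  4 <= complex.Im (square_sum m (fun w : C => w^-1) (- T) (- T) (2 * T)).
Proof.
move=> T0.
(* Im (d / w), whose integral along a side is the angle under which the side is seen
   from the centre, is at least 1; k = 1 or -1 is the orientation of the side. *)
have Edge (k a b u v : R) : (forall t : R, 0 <= t <= 1 ->
    (a + t * u) ^+ 2 + (b + t * v) ^+ 2 <= k * ((a + t * u) * v - (b + t * v) * u) /\
    0 < (a + t * u) ^+ 2 + (b + t * v) ^+ 2) ->
    1 <= complex.Im (k%:C * edge_sum m (fun w : C => w^-1) (a +i* b) (u +i* v)).
  move=> H; rewrite -edge_sumZ; apply: edge_sum_Im => w [t /H[t1 t0] ->].
  have -> : (a +i* b) + t%:C * (u +i* v) = (a + t * u) +i* (b + t * v).
    by rewrite /real_complex_def; simpc.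
  rewrite -mulrA.
  have ImM (r : R) (z : C) : complex.Im (r%:C * z) = r * complex.Im z.
    by case: z => x y; rewrite /real_complex_def; simpc.
  by rewrite ImM Im_invM mulrA ler_pdivlMr // mul1r.
rewrite /square_sum -[- edge_sum _ _ (_ +i* (_ + _)) _]mulN1r.
rewrite -[- edge_sum _ _ _ (0 +i* _)]mulN1r -[X in X + _ + _ + _]mul1r -[X in _ + X + _ + _]mul1r.
have -> : -1 = (-1 : R)%:C :> C by rewrite rmorphN1.
have -> : 1 = (1 : R)%:C :> C by [].
rewrite !ImD (_ : 4 = 1 + 1 + 1 + 1); last by ring.
apply: lerD; [apply: lerD; [apply: lerD|]|]; apply: Edge => t t01.
all: have TT : 0 < T * T by exact: mulr_gt0.
all: have Ttt : 0 <= T * T * (t * (1 - t)) by rewrite !mulr_ge0 //; lra.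
all: have Tu : 0 <= (T * (2 * t - 1)) ^+ 2 by exact: sqr_ge0.
all: by split; nra.
Qed.

(** With g the difference quotient of f at a, one has
f(a) / w = f(w) / (w - a) - a f(a) / (w (w - a)) - g(w).
On a square of half side T the first two terms are O(1/T^2), so their sums are
O(1/T), and the sum of g is negligible by Goursat's lemma, whereas the sum of
1/w stays away from 0.  Hence f(a) = 0. *)
Lemma liouville_vanishing (S : seq C) (f : C -> C) (K r : R) :
  (forall z, {for z, continuous (f : C^o -> C^o)}) ->
  (forall z, z \notin S -> derivable (f : C^o -> C^o) z 1) ->
  (forall z, r <= modulus z -> modulus (f z) * modulus z <= K) ->
  forall z, f z = 0.
Proof.
move=> f_cont f_der f_le.
suff f0 a : a \notin S -> f a = 0.
  move=> z; apply/eqP/negPn/negP => fz0.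
  have fz : 0 < modulus (f z) / 2 by rewrite divr_gt0 // modulus_gt0.
  have [d d0 dP] := continuous_modulus (f_cont z) fz.
  have near_d : \forall w \near (z : C^o)^', modulus (w - z) < d.
    by apply/dnear_modulusP; exists d.
  have [w [wS wz]] := @filter_ex C^o ((z : C^o)^') _ _ (filterI (dnear_notin S z) near_d).
  have := dP w wz; rewrite (f0 w wS) sub0r modulusN.
  by move: fz; lra.
move=> aS; apply/eqP/negPn/negP => fa0.
have [g [fE g_cont g_der]] := difference_quotient f_cont (f_der a aS).
have g_der' z : z \notin a :: S -> derivable (g : C^o -> C^o) z 1.
  by rewrite inE negb_or => /andP[za zS]; apply: g_der => //; exact: f_der.
pose A := modulus (f a); have A0 : 0 < A by rewrite modulus_gt0.
have a0 := modulus_ge0 a.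
pose B := `|K| + A * modulus a; have B0 : 0 <= B by rewrite addr_ge0 // mulr_ge0 // ltW.
(* T exceeds 16 B / A, so that the bound 16 B / T for the sum of u is below A; and
   |w - a| >= |w| / 2 as soon as |w| >= T. *)
pose T := `|r| + 2 * modulus a + 16 * B / A + 1.
have BA0 : 0 <= 16 * B / A by rewrite divr_ge0 ?mulr_ge0 // ltW.
have r0 := normr_ge0 r; have rle := ler_norm r; have Kle := ler_norm K.
have T0 : 0 < T by rewrite /T; lra.
have s0 : 0 < 2 * T by lra.
pose W := square_weight (a :: S) (- T) (- T) (2 * T).
have W0 : 0 <= W by apply: square_weight_ge0; exact: ltW.
have e0 : 0 < A / (W + 1) by rewrite divr_gt0 //; lra.
have [m mP] := square_sum_cvg0 g_cont g_der' e0 (- T) (- T) s0.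
have {mP} := mP m (leqnn m); rewrite -/W => gm.
have {gm}gm : modulus (square_sum m g (- T) (- T) (2 * T)) < A.
  by apply: le_lt_trans gm _; rewrite mulrAC ltr_pdivrMr ?ltr_pM2l //; lra.
pose u w := (f w * w - f a * a) / (w * (w - a)).
have on_sqP w : on_square (- T) (- T) (2 * T) w -> T <= modulus w.
  move=> /(on_squareP (ltW s0))[w1 w2 w3].
  have H1 := Re_le_modulus w; have H2 := Im_le_modulus w.
  have e : - T + 2 * T = T by ring.
  case: w3 => -[] E; rewrite E ?e in H1 H2.
  - by apply: le_trans _ H1; rewrite normrN (gtr0_norm T0).
  - by apply: le_trans _ H1; rewrite (gtr0_norm T0).
  - by apply: le_trans _ H2; rewrite normrN (gtr0_norm T0).
  - by apply: le_trans _ H2; rewrite (gtr0_norm T0).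
have off w : T <= modulus w -> modulus w / 2 <= modulus (w - a).
  move=> Tw; apply: le_trans (lerB_modulus w a).
  by move: Tw; rewrite /T; lra.
have neq w : T <= modulus w -> w != 0 /\ w - a != 0.
  move=> Tw; have := off _ Tw; rewrite -!modulus_gt0; lra.
have sumE : f a * square_sum m (fun w => w^-1) (- T) (- T) (2 * T) =
    square_sum m u (- T) (- T) (2 * T) - square_sum m g (- T) (- T) (2 * T).
  rewrite -square_sumZ -[- square_sum _ g _ _ _]mulN1r -square_sumZ -square_sumD.
  apply: square_sum_ext => w /on_sqP /neq[w0 wa0].
  have -> : g w = (f w - f a) / (w - a) by rewrite (fE w); field.
  by rewrite /u; field; rewrite w0 wa0.
have uT : modulus (square_sum m u (- T) (- T) (2 * T)) <= 4 * ((2 * B / T ^+ 2) * (2 * T)).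
  apply: square_sum_le; first exact: ltW.
  move=> w /on_sqP Tw; have [w0 wa0] := neq w Tw; have wa := off w Tw.
  rewrite /u modulusM modulusV modulusM ler_pdivrMr; last first.
    by rewrite mulr_gt0 // modulus_gt0.
  have H : modulus (f w * w - f a * a) <= B.
    apply: le_trans (modulusB _ _) _; rewrite !modulusM; apply: lerD => //.
    by apply: le_trans Kle; apply: f_le; move: Tw; rewrite /T; lra.
  apply: le_trans H _.
  rewrite mulrAC ler_pdivlMr ?exprn_gt0 // -mulrA.
  rewrite [2 * _]mulrC -mulrA ler_wpM2l // expr2.
  have := modulus_ge0 (w - a); nra.
have main : 4 * A <= 4 * ((2 * B / T ^+ 2) * (2 * T)) + A.
  have Tge := square_sum_inv m T0.
  have Im4 : 4 <= modulus (square_sum m (fun w : C => w^-1) (- T) (- T) (2 * T)).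
    by apply: le_trans Tge _; apply: le_trans (ler_norm _) (Im_le_modulus _).
  rewrite [4 * A]mulrC; apply: le_trans (_ : A * modulus (square_sum m (fun w : C => w^-1) (- T) (- T) (2 * T)) <= _).
    by rewrite ler_pM2l.
  rewrite -modulusM sumE; apply: le_trans (modulusB _ _) _.
  by apply: lerD => //; exact: ltW.
have Tn0 : T != 0 by rewrite gt_eqF.
have E : 4 * ((2 * B / T ^+ 2) * (2 * T)) = 16 * B / T by field.
rewrite E in main.
have : 16 * B / T < A.
  rewrite ltr_pdivrMr //.
  have An0 : A != 0 by rewrite gt_eqF.
  have -> : 16 * B = A * (16 * B / A) by field.
  by rewrite ltr_pM2l // /T; lra.
lra.
Qed.

(** Dividing f - f(a) by z - a lowers the growth exponent by one, at the cost of one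
more exceptional point; this is why the statement allows the set S. *)
Theorem liouville (d : nat) (S : seq C) (f : C -> C) (K r : R) :
  (forall z, {for z, continuous (f : C^o -> C^o)}) ->
  (forall z, z \notin S -> derivable (f : C^o -> C^o) z 1) ->
  (forall z, r <= modulus z -> modulus (f z) * modulus z <= K * modulus z ^+ d) ->
  exists2 p : {poly C}, (size p <= d)%N & forall z, f z = p.[z].
Proof.
elim: d S f K r => [|d IH] S f K r f_cont f_der f_le.
  exists 0; first by rewrite size_poly0.
  move=> z; rewrite horner0; apply: (liouville_vanishing (K := K) (r := r) f_cont f_der).
  by move=> w /f_le; rewrite expr0 mulr1.
have [a aS] := exists_notin S.
have [g [fE g_cont g_der]] := difference_quotient f_cont (f_der a aS).
have g_der' z : z \notin a :: S -> derivable (g : C^o -> C^o) z 1.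
  by rewrite inE negb_or => /andP[za zS]; apply: g_der => //; exact: f_der.
have g_le z : `|r| + 2 * modulus a + 1 <= modulus z ->
    modulus (g z) * modulus z <= (2 * (`|K| + modulus (f a))) * modulus z ^+ d.
  have a0 := modulus_ge0 a; have r0 := normr_ge0 r; have rle := ler_norm r.
  move=> zr; have z1 : 1 <= modulus z by lra.
  have z0 : 0 < modulus z by lra.
  have za : modulus z / 2 <= modulus (z - a) by apply: le_trans (lerB_modulus z a); lra.
  have fz : modulus (f z) <= `|K| * modulus z ^+ d.
    have := f_le z; rewrite exprSr mulrA ler_pM2r // => H.
    apply: le_trans (H _) _; first lra.
    by rewrite ler_wpM2r ?ler_norm // exprn_ge0 // ltW.
  have zd1 : 1 <= modulus z ^+ d by rewrite exprn_ege1.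
  have : modulus (g z) * modulus (z - a) <= (`|K| + modulus (f a)) * modulus z ^+ d.
    rewrite -modulusM mulrC (_ : (z - a) * g z = f z - f a); last by rewrite (fE z); ring.
    apply: le_trans (modulusB _ _) _; rewrite mulrDl; apply: lerD => //.
    by rewrite ler_peMr ?modulus_ge0.
  have := modulus_ge0 (g z); nra.
have [p sp pE] := IH _ _ _ _ g_cont g_der' g_le.
exists ((f a)%:P + ('X - a%:P) * p).
  apply: leq_trans (size_polyD _ _) _; rewrite geq_max.
  rewrite (leq_trans (size_polyC_leq1 _)) //=.
  by apply: leq_trans (size_polyMleq _ _) _; rewrite size_XsubC.
by move=> z; rewrite !hornerE -pE fE.
Qed.

End Liouville.

(** * Clearing the poles of a meromorphic matrix *)

Section Meromorphic.
Local Open Scope complex_scope.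
Variable R : realType.
Local Notation C := R[i].

Lemma derivable_shift (f : C -> C) (c z : C) :
  derivable ((fun w => f (c + w)) : C^o -> C^o) z 1 <-> derivable (f : C^o -> C^o) (c + z) 1.
Proof.
rewrite /derivable; set F := (X in cvg (X @ _)); set G := (X in _ <-> cvg (X @ _)).
by have -> : F = G by apply/funext => h; rewrite /F /G /= addrCA.
Qed.

Lemma horner_derivable (p : {poly C}) (z : C) :
  derivable ((fun w => p.[w]) : C^o -> C^o) z 1.
Proof.
elim/poly_ind: p => [|p c IH].
  have -> : (fun w => (0 : {poly C}).[w]) = cst 0 by apply/funext => w; rewrite horner0.
  exact: derivable_cst.
have -> : (fun w => (p * 'X + c%:P).[w]) = (fun w => p.[w] * w + c).
  by apply/funext => w; rewrite !hornerE.
apply: (@derivableD _ C^o C^o (fun w => p.[w] * w)); last exact: derivable_cst.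
by apply: (@derivableM _ C^o (fun w => p.[w]) id); [exact: IH|exact: derivable_id].
Qed.

Lemma derivable_continuous (f : C -> C) (z : C) :
  derivable (f : C^o -> C^o) z 1 -> {for z, continuous (f : C^o -> C^o)}.
Proof. by move=> /derivable1_diffP /differentiable_continuous. Qed.

Lemma eq_of_near (f g : C -> C) (z : C) :
  {for z, continuous (f : C^o -> C^o)} -> {for z, continuous (g : C^o -> C^o)} ->
  (\forall w \near (z : C^o)^', f w = g w) -> f z = g z.
Proof.
move=> fz gz fg; apply/eqP; rewrite -subr_eq0; apply/negPn/negP => fgz.
have e0 : 0 < modulus (f z - g z) / 3 by rewrite divr_gt0 // modulus_gt0.
have [d d0 dP] := continuous_modulus fz e0.
have [d' d'0 d'P] := continuous_modulus gz e0.
have near_d : \forall w \near (z : C^o)^', modulus (w - z) < Num.min d d'.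
  by apply/dnear_modulusP; exists (Num.min d d') => //; rewrite lt_min d0.
have [w [fgw]] := @filter_ex C^o ((z : C^o)^') _ _ (filterI fg near_d).
rewrite lt_min => /andP[/dP fw /d'P gw].
have := modulusD (f z - g w) (g w - g z); rewrite addrA subrK.
by rewrite (modulus_distC (f z)) -{1}fgw; lra.
Qed.

Lemma horner_bound (p : {poly C}) : exists K : R, forall w, 1 <= modulus w ->
  modulus p.[w] <= K * modulus w ^+ (size p).-1.
Proof.
exists (\sum_(i < size p) modulus p`_i) => w w1.
rewrite horner_coef mulr_suml.
elim/big_ind2: _ => [|x a y b xa yb|i _]; first by rewrite modulus0.
  by apply: le_trans (modulusD _ _) _; exact: lerD.
rewrite modulusM modulusX ler_wpM2l ?modulus_ge0 //.
by rewrite ler_weXn2l // -ltnS (ltn_predK (ltn_ord i)).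
Qed.

(** A neighbourhood of infinity omits only a compact, hence bounded, part of the
plane. *)
Lemma nbhs_infinity (P : set (sphere R)) : nbhs (None : sphere R) P ->
  exists r : R, forall z, r <= modulus z -> P (Some z).
Proof.
move=> [K [cptK _] KP].
have : \forall m \near \oo, K `<=` (fun x => modulus x < m%:R).
  move/compact_near_coveringP : cptK => /(_ nat \oo (fun m x => modulus x < m%:R)); apply.
  move=> x _; exists ([set y | modulus (y - x) < 1], [set m | (Num.bound (modulus x + 1) <= m)%N]).
    split => /=; first by apply/near_modulusP; exists 1.
    by exists (Num.bound (modulus x + 1)).
  case=> y m /= [yx xm]; apply: lt_le_trans (_ : modulus x + 1 <= _); last first.
    have x1 : 0 <= modulus x + 1 by rewrite addr_ge0 ?modulus_ge0.
    apply: ltW; apply: lt_le_trans (archi_boundP x1) _.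
    by rewrite ler_nat.
  by have := lerB_modulus y x; lra.
move=> [m _ /(_ m (leqnn m)) Km]; exists m%:R => z mz; apply: KP; left; exists z => //.
by move=> /Km; rewrite ltNge mz.
Qed.

End Meromorphic.

Section PolynomialForm.
Local Open Scope complex_scope.
Variables (R : realType) (n : nat).
Local Notation C := R[i].

Lemma cdifferentiable_entry (h : C -> 'M[C]_n) z i j :
  cdifferentiable_at h z -> {for z, continuous ((fun w => h w i j) : C^o -> C^o)}.
Proof. by move=> /(_ i j); exact: derivable_continuous. Qed.

Lemma cdifferentiable_scale (p : {poly C}) (h : C -> 'M[C]_n) z :
  cdifferentiable_at h z -> cdifferentiable_at (fun w => p.[w] *: h w) z.
Proof.
move=> dh i j; have -> : (fun w : C^o => (p.[w] *: h w) i j : C^o) =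
    (fun w : C^o => p.[w] * h w i j : C^o) by apply/funext => w; rewrite mxE.
apply: (@derivableM _ C^o (fun w => p.[w])); first exact: horner_derivable.
exact: dh.
Qed.

(** The values of f at its poles being irrelevant, the product p f is compared with
a holomorphic matrix on a punctured neighbourhood only. *)
Definition clears_poles (f : sphere R -> 'M[C]_n) (p : {poly C}) (z : C) :=
  exists2 h : C -> 'M[C]_n, (\forall w \near (z : C^o), cdifferentiable_at h w) &
    \forall w \near (z : C^o)^', p.[w] *: f (Some w) = h w.

Lemma clears_polesM f p q z : clears_poles f p z -> clears_poles f (q * p) z.
Proof.
move=> [h dh fh]; exists (fun w => q.[w] *: h w).
  by apply: filterS dh => w; exact: cdifferentiable_scale.
by apply: filterS fh => w <-; rewrite hornerM scalerA.
Qed.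

Lemma meromorphic_clears f c : meromorphic f -> exists2 p : {poly C}, p \is monic &
  exists2 d : R, 0 < d & forall z, modulus (z - c) < d -> clears_poles f p z.
Proof.
move=> /(_ (Some c))[k [h [/near_modulusP[d1 d10 dh] /dnear_modulusP[d2 d20 fh]]]].
pose p : {poly C} := ('X - c%:P) ^+ k.
exists p; first by rewrite monic_exp ?monicXsubC.
have dh' w : modulus (w - c) < d1 -> cdifferentiable_at (fun w => h (- c + w)) w.
  move=> wc i j; apply/(derivable_shift (fun w => h w i j)); apply: dh.
  by rewrite subr0 addrC.
have fh' w : modulus (w - c) < d2 -> w != c -> p.[w] *: f (Some w) = h (- c + w).
  move=> wc wnc; have := fh (w - c); rewrite subr0 subr_eq0 => /(_ wc wnc).
  by rewrite /chart addrCA subrr addr0 /p !hornerE addrC.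
exists (Num.min d1 d2); first by rewrite lt_min d10.
move=> z; rewrite lt_min => /andP[zd1 zd2].
have near_z d : modulus (z - c) < d -> \forall w \near (z : C^o), modulus (w - c) < d.
  move=> zd; apply/near_modulusP; exists (d - modulus (z - c)); first by rewrite subr_gt0.
  by move=> w wz; have := modulusD (w - z) (z - c); rewrite addrA subrK; lra.
exists (fun w => h (- c + w)).
  by apply: filterS (near_z _ zd1) => w; exact: dh'.
have := dnear_neq z c; have := nbhs_dnbhs (near_z _ zd2).
by apply: filterS2 => w; exact: fh'.
Qed.

(** A bounded region contains finitely many poles: the product of the polynomials
that work for the four quarters works for the whole square. *)
Lemma meromorphic_clears_square f : meromorphic f -> forall x y s : R, 0 < s ->
  exists2 p : {poly C}, p \is monic & forall z : C,
    x <= complex.Re z <= x + s -> y <= complex.Im z <= y + s -> clears_poles f p z.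
Proof.
move=> mf; apply: square_bisection => [x y s s0|a b].
  move=> [p1 m1 H1] [p2 m2 H2] [p3 m3 H3] [p4 m4 H4].
  exists (p1 * p2 * p3 * p4); first by rewrite !monicMl.
  move=> z zx zy.
  have [zx2|zx2] := leP (complex.Re z) (x + s / 2); have [zy2|zy2] := leP (complex.Im z) (y + s / 2).
  - rewrite -!mulrA mulrC; apply: clears_polesM; apply: H1; lra.
  - rewrite mulrAC; apply: clears_polesM; apply: H3; lra.
  - rewrite -!mulrA mulrCA mulrC; apply: clears_polesM; apply: H2; lra.
  - by apply: clears_polesM; apply: H4; lra.
have [p mp [d d0 dP]] := meromorphic_clears (a +i* b) mf.
exists (d / 2); first lra.
move=> x y s /andP[s0 sd] xa yb; exists p => // z xz yz; apply: dP.
apply: le_lt_trans (modulus_le_ReIm _) _; rewrite ReD ImD ReN ImN /=.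
have : `|complex.Re z - a| <= s by rewrite ler_norml; lra.
have : `|complex.Im z - b| <= s by rewrite ler_norml; lra.
lra.
Qed.

Lemma dom_near (g : loop R n) z : dom g (Some z) -> \forall w \near (z : C^o), dom g (Some w).
Proof. by move=> gz; exact: (open_nbhs_nbhs (conj (@dom_open _ _ g) gz)). Qed.

Lemma loop_cdifferentiable (g : loop R n) z : dom g (Some z) ->
  cdifferentiable_at (fun w => g (Some w)) z.
Proof.
move=> gz i j; have := @eval_holomorphic _ _ g _ gz i j.
by move/(derivable_shift (fun w => g (Some w) i j) z 0); rewrite addr0.
Qed.

(** The coordinate at infinity is 1/z, and a differentiable function is Lipschitz at
the point. *)
Lemma loop_bound_infinity (g : loop R n) : negative g -> exists K r : R,
  forall z, r <= modulus z -> dom g (Some z) /\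
    forall i j, modulus (g (Some z) i j - (i == j)%:R) * modulus z <= K.
Proof.
move=> [gI g1].
have entry (ij : 'I_n * 'I_n) : exists Kr : R * R, forall z, Kr.2 <= modulus z ->
    modulus (g (Some z) ij.1 ij.2 - (ij.1 == ij.2)%:R) * modulus z <= Kr.1.
  case: ij => i j /=.
  have [l lP] := derivable_modulus (@eval_holomorphic _ _ g _ gI i j).
  have [d d0 dP] := lP 1 ltr01.
  exists (1 + modulus l, d^-1 + 1) => /= z zd.
  have z0 : 0 < modulus z by apply: lt_le_trans zd; rewrite addr_gt0 ?invr_gt0.
  have zn0 : z != 0 by rewrite -modulus_gt0.
  have zd' : (modulus z)^-1 < d.
    by rewrite invf_plt ?posrE //; apply: lt_le_trans zd; lra.
  have := dP z^-1; rewrite subr0 modulusV => /(_ zd').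
  rewrite /= eqxx invr_eq0 (negPf zn0) invrK g1 mxE mul1r -ler_pdivlMr // [l * _]mulrC => H.
  have := modulusD (g (Some z) i j - (i == j)%:R - z^-1 * l) (z^-1 * l).
  rewrite subrK modulusM modulusV mulrDl mul1r; lra.
have [r1 r1P] := nbhs_infinity (open_nbhs_nbhs (conj (@dom_open _ _ g) gI)).
have [Kr KrP] := choice entry.
pose K i j := (Kr (i, j)).1; pose r i j := (Kr (i, j)).2.
exists (\sum_i \sum_j `|K i j|), (`|r1| + \sum_i \sum_j `|r i j|) => z zr.
have sum_ge (u : 'I_n -> 'I_n -> R) i j : u i j <= \sum_i \sum_j `|u i j|.
  rewrite (bigD1 i) //= (bigD1 j) //= -addrA.
  apply: le_trans (ler_norm _) _; rewrite lerDl addr_ge0 ?sumr_ge0 // => k _.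
  by rewrite sumr_ge0.
split.
  apply: r1P; apply: le_trans (ler_norm _) _; apply: le_trans zr.
  by rewrite lerDl sumr_ge0 // => k _; rewrite sumr_ge0.
move=> i j; apply: le_trans (sum_ge K i j); apply: (KrP (i, j)).
apply: le_trans (sum_ge r i j) _.
by apply: le_trans zr; rewrite lerDr.
Qed.

(** Outside a large square the loop itself is holomorphic, so the polynomial which
clears the poles inside that square clears all of them.  Applying [liouville] to
p (g - I) rather than to p g yields the degree bound which expresses that g is
the identity at infinity. *)
Theorem loop_polynomial_form (g : loop R n) : Defs.rational g -> negative g ->
  exists (p : {poly C}) (N : 'M[{poly C}]_n), [/\ p \is monic,
    forall i j, (size (N i j - p *+ (i == j))%R < size p)%N &
    forall z, dom g (Some z) -> forall i j, (N i j).[z] = p.[z] * g (Some z) i j].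
Proof.
move=> [f [mf gf]] neg_g.
have [K [r gK]] := loop_bound_infinity neg_g.
pose T := `|r| + 1; have T0 : 0 < 2 * T by have := normr_ge0 r; rewrite /T; lra.
have [p mp pP] := meromorphic_clears_square mf (- T) (- T) T0.
exists p.
have clear_dom z : dom g (Some z) -> clears_poles f p z.
  move=> gz; exists (fun w => p.[w] *: g (Some w)).
    by apply: filterS (dom_near gz) => w gw; exact/cdifferentiable_scale/loop_cdifferentiable.
  by apply: nbhs_dnbhs; apply: filterS (dom_near gz) => w gw; rewrite gf.
have clear z : clears_poles f p z.
  have [zr|zr] := lerP r (modulus z); first by apply: clear_dom; case: (gK z zr).
  have zT : modulus z < T by rewrite /T; have := ler_norm r; lra.
  have := Re_le_modulus z; have := Im_le_modulus z; rewrite !ler_norml => zi zre.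
  by apply: pP; lra.
(* H z extends p f holomorphically around z; by uniqueness of limits the local
   extensions agree, and z |-> H z z is an entire one. *)
pose H z := projT1 (cid2 (clear z)).
have dH z : \forall w \near (z : C^o), cdifferentiable_at (H z) w.
  by rewrite /H; case: (cid2 _).
have fH z : \forall w \near (z : C^o)^', p.[w] *: f (Some w) = H z w.
  by rewrite /H; case: (cid2 _).
have HE z : \forall w \near (z : C^o), H w w = H z w.
  have /near_modulusP[d1 d10 d1P] := dH z.
  have /dnear_modulusP[d2 d20 d2P] := fH z.
  apply/near_modulusP; exists (Num.min d1 d2); first by rewrite lt_min d10.
  move=> w; rewrite lt_min => /andP[wd1 wd2]; apply/matrixP => i j.
  apply: (@eq_of_near _ (fun v => H w v i j) (fun v => H z v i j)).
  - by apply: cdifferentiable_entry; exact: (@nbhs_singleton C^o _ _ (dH w)).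
  - by apply: cdifferentiable_entry; exact: d1P _ wd1.
  have near_z : \forall v \near (w : C^o)^', modulus (v - z) < d2.
    apply: nbhs_dnbhs; apply/near_modulusP; exists (d2 - modulus (w - z)); first by rewrite subr_gt0.
    by move=> v vw; have := modulusD (v - w) (w - z); rewrite addrA subrK; lra.
  have := fH w; have := near_z; have := dnear_neq w z.
  by apply: filterS3 => v vz vd <-; rewrite d2P.
pose F i j z := H z z i j.
have dF i j z : derivable (F i j : C^o -> C^o) z 1.
  have : \forall w \near (z : C^o), H z w i j = F i j w.
    by apply: filterS (HE z) => w; rewrite /F => ->.
  move=> HF; apply: (@near_eq_derivable C C^o C^o (fun w => H z w i j) (F i j) z 1 HF).
  exact: (@nbhs_singleton C^o _ _ (dH z) i j).
have Fg i j z : dom g (Some z) -> F i j z = p.[z] * g (Some z) i j.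
  move=> gz; apply: (@eq_of_near _ (fun w => H z w i j) (fun w => p.[w] * g (Some w) i j)).
  - by apply: cdifferentiable_entry; exact: (@nbhs_singleton C^o _ _ (dH z)).
  - have -> : (fun w => p.[w] * g (Some w) i j) = (fun w => (p.[w] *: g (Some w)) i j).
      by apply/funext => w; rewrite mxE.
    by apply: cdifferentiable_entry; apply: cdifferentiable_scale; exact: loop_cdifferentiable.
  have := fH z; have := nbhs_dnbhs (dom_near gz).
  by apply: filterS2 => w gw <-; rewrite mxE gf.
have Q i j : exists2 q : {poly C}, (size q <= (size p).-1)%N &
    forall z, F i j z - p.[z] *+ (i == j) = q.[z].
  have [B BP] := horner_bound p.
  have dpij z : derivable ((fun w => p.[w] *+ (i == j)) : C^o -> C^o) z 1.
    have -> : (fun w => p.[w] *+ (i == j)) = (fun w => (p *+ (i == j)).[w]).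
      by apply/funext => w; rewrite hornerMn.
    exact: horner_derivable.
  apply: (@liouville _ _ [::] _ (B * `|K|) (`|r| + 1)).
  - move=> z; apply: derivable_continuous; apply: derivableB; first exact: dF.
    exact: dpij.
  - move=> z _; apply: derivableB; first exact: dF.
    exact: dpij.
  move=> z zr; have [r0 rr] := (normr_ge0 r, ler_norm r).
  have [gz gzK] : dom g (Some z) /\ forall i j,
      modulus (g (Some z) i j - (i == j)%:R) * modulus z <= K by apply: gK; lra.
  rewrite Fg // -mulr_natr -mulrBr modulusM -mulrA mulrAC.
  apply: ler_pM; rewrite ?mulr_ge0 ?modulus_ge0 //; first by apply: BP; lra.
  by apply: le_trans (ler_norm K); exact: gzK.
pose q i j := projT1 (cid2 (Q i j)).
exists (\matrix_(i, j) (q i j + p *+ (i == j))); split=> // [i j|z gz i j].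
  rewrite mxE addrK /q; case: (cid2 _) => /= u su _.
  apply: leq_ltn_trans su _; rewrite prednK ?leqnn //.
  by rewrite size_poly_gt0 monic_neq0.
rewrite -Fg // mxE hornerD hornerMn /q; case: (cid2 _) => /= u _ <-.
by rewrite subrK.
Qed.

End PolynomialForm.

(** * The projections of an isotropic line, in terms of a spanning vector *)

Section LineProjections.
Context {C : numClosedFieldType} {n : nat}.
Local Notation conjmx := (map_mx Num.conj).

Definition hnorm (v : 'cV[C]_n) : C := (v^T *m conjmx v) 0 0.

Lemma hnormE (v : 'cV[C]_n) : v^T *m conjmx v = (hnorm v)%:M.
Proof. exact: mx11_scalar. Qed.

Lemma hnorm_conjl (v : 'cV[C]_n) : (conjmx v)^T *m v = (hnorm v)%:M.
Proof. by rewrite -[LHS]trmxK trmx_mul trmxK hnormE tr_scalar_mx. Qed.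

Lemma hnorm_eq0 (v : 'cV[C]_n) : (hnorm v == 0) = (v == 0).
Proof.
apply/eqP/eqP => [v0|->]; last by rewrite /hnorm trmx0 mul0mx mxE.
apply: trmx_inj; rewrite trmx0; apply: mulmx_conj_eq0.
by rewrite map_trmx trmxK hnormE v0 raddf0.
Qed.

Lemma hnorm_conj (v : 'cV[C]_n) : (hnorm v)^* = hnorm v.
Proof.
rewrite /hnorm mxE rmorph_sum /=; apply: eq_bigr => k _.
by rewrite !mxE rmorphM /= conjCK mulrC.
Qed.

Section Vector.
Variables (L : isotropic_line C n) (v : 'cV[C]_n).
Hypotheses (v_neq0 : v != 0) (vL : (v^T <= L)%MS).
Let k := hnorm v.

Let k_neq0 : k != 0. Proof. by rewrite /k hnorm_eq0. Qed.

Let LvE : (line_mx L :=: v^T)%MS.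
Proof.
apply/eqmx_sym/eqmxP; rewrite vL /= -(geq_leqif (mxrank_leqif_sup vL)) line_rank.
by rewrite rank_rV trmx_eq0 v_neq0.
Qed.

Let LvcE : (conj_space L :=: (conjmx v)^T)%MS.
Proof.
rewrite map_trmx; apply/eqmxP; rewrite /conj_space !map_submx.
by rewrite !LvE submx_refl.
Qed.

Let dec1 : exists a b c : 'M[C]_n, [/\ (a <= line_mx L)%MS, (b <= conj_space L)%MS,
  (c <= mid_space L)%MS & [/\ 1%:M = b + c + a, rproj_line L = a, rproj_conj L = b & rproj_perp L = c]].
Proof.
case: (line_decP L 1%:M) => a b c; rewrite !mul1mx => aA bB cM E Ea Eb Ec.
by exists a, b, c.
Qed.

Let vcL : ((conjmx v)^T <= conj_space L)%MS. Proof. by rewrite LvcE submx_refl. Qed.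

(** Pairing with v kills L and its middle space, hence detects exactly the component
along the conjugate line. *)
Lemma pi_conjE : pi_conj L = k^-1 *: (conjmx v *m v^T).
Proof.
have [a [b [c [aA bB cM [E _ Eb _]]]]] := dec1.
have vE : v = b *m v.
  rewrite -{1}[v]mul1mx E !mulmxDl -{2 3}[v]trmxK (line_orth aA vL) addr0.
  by rewrite (perpP cM (submx_trans vL (addsmxSl _ _))) addr0.
have [D bE] : exists D, b = D *m (conjmx v)^T by apply/submxP; rewrite -LvcE.
have DE : D = k^-1 *: v.
  by rewrite vE bE -mulmxA hnorm_conjl mul_mx_scalar scalerA mulVf // scale1r.
have -> : pi_conj L = (rproj_conj L)^T by [].
by rewrite Eb bE DE -scalemxAl linearZ /= trmx_mul trmxK.
Qed.

(** Pairing with the conjugate of v kills the conjugate line and the middle space. *)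
Lemma pi_lineE : pi_line L = k^-1 *: (v *m (conjmx v)^T).
Proof.
have [a [b [c [aA bB cM [E Ea _ _]]]]] := dec1.
have vE : conjmx v = a *m conjmx v.
  rewrite -{1}[conjmx v]mul1mx E !mulmxDl -{1 2}[conjmx v]trmxK (conj_line_orth bB vcL) add0r.
  by rewrite (perpP cM (submx_trans vcL (addsmxSr _ _))) add0r.
have [D aE] : exists D, a = D *m v^T by apply/submxP; rewrite -LvE.
have DE : D = k^-1 *: conjmx v.
  by rewrite vE aE -mulmxA hnormE mul_mx_scalar scalerA mulVf // scale1r.
have -> : pi_line L = (rproj_line L)^T by [].
by rewrite Ea aE DE -scalemxAl linearZ /= trmx_mul trmxK.
Qed.

Lemma pi_midE : pi_mid L = 1%:M - pi_conj L - pi_line L.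
Proof.
have [a [b [c [aA bB cM [E Ea Eb Ec]]]]] := dec1.
have -> : pi_mid L = (rproj_perp L)^T by [].
have -> : pi_conj L = (rproj_conj L)^T by [].
have -> : pi_line L = (rproj_line L)^T by [].
rewrite Ea Eb Ec -[1%:M]trmx1 E !linearD /=.
by rewrite addrAC addrK addrC addrA addNr add0r.
Qed.

End Vector.

Lemma line_vector (L : isotropic_line C n) : exists2 v : 'cV[C]_n, v != 0 & (v^T <= L)%MS.
Proof.
have : line_mx L != 0 by rewrite -mxrank_eq0 line_rank.
case/matrix0Pn => i [j Lij]; exists (row i L)^T; last by rewrite trmxK row_sub.
by apply/eqP => /matrixP/(_ j 0); rewrite !mxE; exact/eqP.
Qed.

Lemma conj_pi_conj (L : isotropic_line C n) : conjmx (pi_conj L) = pi_line L.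
Proof.
have [v v0 vL] := line_vector L.
rewrite (pi_conjE v0 vL) (pi_lineE v0 vL) map_mxZ map_mxM fmorphV /= hnorm_conj.
by rewrite conj_spaceK map_trmx.
Qed.

Lemma conj_projections (L : isotropic_line C n) (x y : C) :
  conjmx (x *: pi_conj L + pi_mid L + y *: pi_line L) =
  y^* *: pi_conj L + pi_mid L + x^* *: pi_line L.
Proof.
have conj_pi_line : conjmx (pi_line L) = pi_conj L by rewrite -conj_pi_conj conj_spaceK.
have conj_pi_mid : conjmx (pi_mid L) = pi_mid L.
  by rewrite pi_midE !map_mxB map_mx1 conj_pi_conj conj_pi_line addrAC.
rewrite !map_mxD !map_mxZ conj_pi_conj conj_pi_line conj_pi_mid.
by rewrite addrC [_ + pi_mid L]addrC addrA.
Qed.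

Lemma vector_line (v : 'cV[C]_n) : v != 0 -> v^T *m v = 0 ->
  exists L : isotropic_line C n, (v^T <= L)%MS.
Proof.
move=> v0 vv.
have rk : \rank <<v^T>>%MS = 1%N by rewrite genmxE rank_rV trmx_eq0 v0.
have iso (u w : 'cV[C]_n) : (u^T <= <<v^T>>)%MS -> (w^T <= <<v^T>>)%MS -> dotv u w = 0.
  rewrite !genmxE => /sub_rVP[a uE] /sub_rVP[b wE].
  have {}wE : w = b *: v by rewrite -[w]trmxK wE linearZ /= trmxK.
  have := dotv_mx u w; rewrite uE {1}wE -scalemxAl -scalemxAr vv !scaler0.
  by move/matrixP/(_ 0 0); rewrite !mxE mulr1n.
by exists (IsotropicLine rk iso); rewrite /= genmxE submx_refl.
Qed.

End LineProjections.

(** * Lowering the rank at a pole *)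

Section RankOneCorrection.
Variables (A : comNzRingType) (n : nat).
Variables (N : 'M[A]_n) (v w : 'cV[A]_n) (Y Z : 'rV[A]_n) (a b c k : A).
Hypotheses (vN : v^T *m N = a *: Y) (wN : w^T *m N = b *: Z).
Hypotheses (vv : v^T *m v = 0) (ww : w^T *m w = 0) (vw : v^T *m w = k%:M).
Hypothesis (ab : b - a = c * k).

(** Multiplication by an orthogonal matrix preserves N^T N.  In the application
N' = p_{alpha,L} N with a = X - alpha, b = X - conj alpha and w = conj v; this
form of the identity avoids denominators. *)
Lemma rank_one_correction_gram :
  let N' := N + c *: (w *m Y - v *m Z) in N'^T *m N' = N^T *m N.
Proof.
have wv : w^T *m v = k%:M by rewrite -[LHS]trmxK trmx_mul trmxK vw tr_scalar_mx.
have Nv : N^T *m v = a *: Y^T by rewrite -[LHS]trmxK trmx_mul trmxK vN linearZ.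
have Nw : N^T *m w = b *: Z^T by rewrite -[LHS]trmxK trmx_mul trmxK wN linearZ.
set D := w *m Y - v *m Z => N'.
have DT : D^T = Y^T *m w^T - Z^T *m v^T by rewrite linearB /= !trmx_mul.
pose S := Y^T *m Z + Z^T *m Y.
have ND : N^T *m D = b *: (Z^T *m Y) - a *: (Y^T *m Z).
  by rewrite mulmxBr !mulmxA Nw Nv -!scalemxAl.
have DN : D^T *m N = b *: (Y^T *m Z) - a *: (Z^T *m Y).
  by rewrite DT mulmxBl -!mulmxA vN wN -!scalemxAr.
have DD : D^T *m D = - k *: S.
  rewrite DT mulmxBl !mulmxBr -!mulmxA !(mulmxA w^T) !(mulmxA v^T) vv ww vw wv.
  rewrite !mul_scalar_mx !mul0mx !mulmx0 -!scalemxAr sub0r subr0 /S scaleNr scalerDr.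
  by rewrite opprD.
have NDN : N^T *m D + D^T *m N = (b - a) *: S.
  rewrite ND DN /S; move: (Z^T *m Y) (Y^T *m Z) => P Q.
  by apply/matrixP => i j; rewrite !mxE; ring.
have N'T : N'^T = N^T + c *: D^T by rewrite /N' linearD /= linearZ.
rewrite N'T /N' mulmxDl !mulmxDr -!scalemxAl -!scalemxAr DD.
rewrite -[RHS]addr0 -!addrA; congr (_ + _); rewrite addrA -scalerDr NDN ab !scalerA -scalerDl.
by rewrite mulrN mulrA subrr scale0r.
Qed.

End RankOneCorrection.

Section Evaluation.
Variable C : numClosedFieldType.

Definition eval_mx m n (z : C) (N : 'M[{poly C}]_(m, n)) := map_mx (horner_eval z) N.
Definition deriv_mx m n (N : 'M[{poly C}]_(m, n)) := map_mx (@deriv C) N.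
Definition conj_mx m n (N : 'M[{poly C}]_(m, n)) := map_mx (map_poly Num.conj) N.

Lemma deriv_mxM m n p (M : 'M[{poly C}]_(m, n)) (N : 'M[{poly C}]_(n, p)) :
  deriv_mx (M *m N) = deriv_mx M *m N + M *m deriv_mx N.
Proof.
apply/matrixP => i j; rewrite !mxE raddf_sum -big_split /=; apply: eq_bigr => k _.
by rewrite derivM !mxE.
Qed.

Lemma deriv_mx_tr m n (M : 'M[{poly C}]_(m, n)) : deriv_mx M^T = (deriv_mx M)^T.
Proof. by rewrite /deriv_mx map_trmx. Qed.

Lemma deriv_mx_polyC m n (M : 'M[C]_(m, n)) : deriv_mx (map_mx polyC M) = 0.
Proof. by apply/matrixP => i j; rewrite !mxE derivC. Qed.

Lemma eval_mx_polyC m n (M : 'M[C]_(m, n)) z : eval_mx z (map_mx polyC M) = M.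
Proof. by apply/matrixP => i j; rewrite !mxE /horner_eval hornerC. Qed.

Lemma eval_mxM m n p (M : 'M[{poly C}]_(m, n)) (N : 'M[{poly C}]_(n, p)) z :
  eval_mx z (M *m N) = eval_mx z M *m eval_mx z N.
Proof. exact: map_mxM. Qed.

Lemma eval_mxD m n (M N : 'M[{poly C}]_(m, n)) z :
  eval_mx z (M + N) = eval_mx z M + eval_mx z N.
Proof. exact: map_mxD. Qed.

Lemma eval_mxB m n (M N : 'M[{poly C}]_(m, n)) z :
  eval_mx z (M - N) = eval_mx z M - eval_mx z N.
Proof. exact: map_mxB. Qed.

Lemma eval_mxZ m n (q : {poly C}) (M : 'M[{poly C}]_(m, n)) z :
  eval_mx z (q *: M) = q.[z] *: eval_mx z M.
Proof. by apply/matrixP => i j; rewrite !mxE /horner_eval hornerM. Qed.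

Lemma eval_mx_tr m n (M : 'M[{poly C}]_(m, n)) z : eval_mx z M^T = (eval_mx z M)^T.
Proof. by rewrite /eval_mx map_trmx. Qed.

Lemma root_factor_mx m n (M : 'M[{poly C}]_(m, n)) z : eval_mx z M = 0 ->
  exists Q, M = ('X - z%:P) *: Q.
Proof.
move=> M0; exists (map_mx (fun q => q %/ ('X - z%:P)) M).
apply/matrixP => i j; rewrite !mxE mulrC divpK // dvdp_XsubCl.
by move/matrixP/(_ i j): M0; rewrite !mxE => /eqP.
Qed.

End Evaluation.

Section PoleReduction.
Variables (C : numClosedFieldType) (n : nat).
Local Notation conjmx := (map_mx Num.conj).

(** The rational matrix N / p is real, orthogonal, and equal to the identity at
infinity. *)
Record real_orthogonal_form (p : {poly C}) (N : 'M[{poly C}]_n) : Prop := RealOrthogonalForm {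
  form_monic : p \is monic;
  form_real_den : map_poly Num.conj p = p;
  form_real : conj_mx N = N;
  form_gram : N^T *m N = (p ^+ 2)%:M;
  form_infty : forall i j, (size (N i j - p *+ (i == j))%R < size p)%N }.

(** The value at z of the simple element p_{alpha,L}, where L is spanned by v. *)
Definition simple_factor (alpha : C) (v : 'cV[C]_n) (z : C) : 'M[C]_n :=
  1%:M + ((alpha - alpha^*) / hnorm v) *:
    ((z - alpha)^-1 *: (conjmx v *m v^T) - (z - alpha^*)^-1 *: (v *m (conjmx v)^T)).

Section Step.
Variables (p : {poly C}) (N : 'M[{poly C}]_n) (alpha : C).
Hypotheses (pN : real_orthogonal_form p N) (p0 : root p alpha).
Let N0 := eval_mx alpha N.

Lemma eval_conj_mx z : conjmx (eval_mx z N) = eval_mx z^* N.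
Proof.
rewrite -{2}(form_real pN); apply/matrixP => i j.
by rewrite !mxE /horner_eval -{2}(conjCK z) horner_map conjCK.
Qed.

Lemma eval_gram0 : N0^T *m N0 = 0.
Proof.
rewrite /N0 -eval_mx_tr -eval_mxM (form_gram pN); apply/matrixP => i j.
by rewrite !mxE /horner_eval hornerMn horner_exp (eqP p0) expr0n mul0rn.
Qed.

(** At a real point the matrix N0 is real, so that N0^T N0 = 0 forces N0 = 0. *)
Lemma eval_real_root0 : alpha^* = alpha -> N0 = 0.
Proof.
move=> ar; apply: trmx_inj; rewrite trmx0; apply: mulmx_conj_eq0.
by rewrite map_trmx trmxK /N0 eval_conj_mx ar; exact: eval_gram0.
Qed.

(** The vector v is a nonzero column N0 e of N0, and N' is the product of N with the
simple element attached to alpha and v.  The new value at alpha has the form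
K N0, so its rank can only drop; it kills e while N0 e = v does not vanish. *)
Lemma reduce_rank : alpha^* != alpha -> N0 != 0 ->
  exists (v : 'cV[C]_n) (N' : 'M[{poly C}]_n), [/\ v != 0, v^T *m v = 0,
    real_orthogonal_form p N', (\rank (eval_mx alpha N') < \rank N0)%N &
    forall z, z != alpha -> z != alpha^* ->
      eval_mx z N' = simple_factor alpha v z *m eval_mx z N].
Proof.
move=> a_nreal N0_neq0.
have [i [j Nij]] := matrix0Pn _ N0_neq0.
pose e : 'cV[C]_n := delta_mx j 0.
have [v vE] : exists v, v = N0 *m e by exists (N0 *m e).
pose k := hnorm v; pose w := conjmx v.
have v0 : v != 0.
  by apply: contraNneq Nij => /matrixP/(_ i 0); rewrite vE /e -colE [LHS]mxE [RHS]mxE => ->.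
have k0 : k != 0 by rewrite /k hnorm_eq0.
have vN0 : v^T *m N0 = 0 by rewrite vE trmx_mul -mulmxA eval_gram0 mulmx0.
have vv : v^T *m v = 0 by rewrite {2}vE mulmxA vN0 mul0mx.
have ww : w^T *m w = 0 by rewrite /w map_trmx -map_mxM vv map_mx0.
pose vP := map_mx polyC v; pose wP := map_mx polyC w.
(* v^T N0 = 0: the pole of the simple element at alpha is cancelled. *)
have [Y vNY] : exists Y, vP^T *m N = ('X - alpha%:P) *: Y.
  by apply: root_factor_mx; rewrite eval_mxM eval_mx_tr eval_mx_polyC vN0.
pose Z := conj_mx Y.
have conj_vP : conj_mx vP = wP by apply/matrixP => s t; rewrite !mxE map_polyC.
have conj_wP : conj_mx wP = vP by apply/matrixP => s t; rewrite !mxE map_polyC /= conjCK.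
have conj_Z : conj_mx Z = Y.
  by apply/matrixP => s t; rewrite !mxE -map_poly_comp map_poly_id // => x _; exact: conjCK.
(* By reality the pole at the conjugate of alpha is cancelled as well. *)
have wNZ : wP^T *m N = ('X - alpha^*%:P) *: Z.
  rewrite -conj_vP -{1}(form_real pN) /conj_mx map_trmx -map_mxM vNY map_mxZ.
  by rewrite rmorphB /= map_polyX map_polyC.
pose c := (alpha - alpha^*) / k.
pose N' := N + c%:P *: (wP *m Y - vP *m Z).
have cc : c^* = - c.
  by rewrite /c /k rmorphM rmorphB /= conjCK fmorphV /= hnorm_conj -mulNr opprB.
have ck : c * k = alpha - alpha^* by rewrite divfK.
exists v, N'; split=> //; last first.
- move=> z za zac; rewrite eval_mxD eval_mxZ hornerC eval_mxB !eval_mxM !eval_mx_polyC.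
  have vNz : v^T *m eval_mx z N = (z - alpha) *: eval_mx z Y.
    by have := congr1 (eval_mx z) vNY; rewrite eval_mxM eval_mx_tr eval_mx_polyC eval_mxZ !hornerE.
  have wNz : w^T *m eval_mx z N = (z - alpha^*) *: eval_mx z Z.
    by have := congr1 (eval_mx z) wNZ; rewrite eval_mxM eval_mx_tr eval_mx_polyC eval_mxZ !hornerE.
  rewrite /simple_factor -/w -/k -/c mulmxDl mul1mx; congr (_ + _).
  rewrite -scalemxAl; congr (_ *: _); rewrite mulmxBl -!scalemxAl -!mulmxA vNz wNz -!scalemxAr !scalerA.
  by rewrite !mulVf ?scale1r // subr_eq0.
- pose N1 := eval_mx alpha (deriv_mx N).
  (* First order term of N^T N = p^2 at alpha. *)
  have skew : N0^T *m N1 = - (N1^T *m N0).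
    have := congr1 (fun M => eval_mx alpha (deriv_mx M)) (form_gram pN).
    rewrite deriv_mxM eval_mxD !eval_mxM deriv_mx_tr !eval_mx_tr -/N0 -/N1.
    have -> : eval_mx alpha (deriv_mx (p ^+ 2)%:M) = 0 :> 'M_n.
      apply/matrixP => s t; rewrite !mxE derivMn expr2 derivM /horner_eval hornerMn hornerD !hornerM.
      by rewrite (eqP p0) mulr0 mul0r addr0 mul0rn.
    by move/eqP; rewrite addrC addr_eq0 => /eqP.
  have Y0 : eval_mx alpha Y = v^T *m N1.
    have := congr1 (fun M => eval_mx alpha (deriv_mx M)) vNY.
    rewrite deriv_mxM deriv_mx_tr deriv_mx_polyC trmx0 mul0mx add0r eval_mxM eval_mx_tr eval_mx_polyC => ->.
    apply/matrixP => s t; rewrite !mxE /horner_eval derivM derivXsubC mul1r hornerD hornerM.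
    by rewrite hornerXsubC subrr mul0r addr0.
  have Z0 : (alpha - alpha^*) *: eval_mx alpha Z = w^T *m N0.
    have := congr1 (eval_mx alpha) wNZ.
    by rewrite eval_mxM eval_mx_tr eval_mx_polyC eval_mxZ !hornerE.
  have cZ0 : c *: eval_mx alpha Z = k^-1 *: (w^T *m N0).
    by rewrite -Z0 scalerA mulrC.
  have N'0 : eval_mx alpha N' = N0 + c *: (w *m (v^T *m N1)) - k^-1 *: (v *m (w^T *m N0)).
    rewrite eval_mxD eval_mxZ hornerC eval_mxB !eval_mxM !eval_mx_polyC -/N0 Y0 scalerBr addrA.
    by rewrite [c *: (v *m _)]scalemxAr cZ0 -scalemxAr.
  have vN1 : v^T *m N1 = - (e^T *m N1^T *m N0).
    by rewrite vE trmx_mul -(mulmxA e^T N0^T N1) skew mulmxN mulmxA.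
  have N'K : eval_mx alpha N' = (1%:M - c *: (w *m e^T *m N1^T) - k^-1 *: (v *m w^T)) *m N0.
    by rewrite N'0 vN1 !mulmxBl mul1mx -!scalemxAl mulmxN scalerN !mulmxA.
  (* A one by one matrix which is the opposite of its transpose. *)
  have vN1e : v^T *m N1 *m e = 0.
    have t : v^T *m N1 *m e = - (v^T *m N1 *m e)^T.
      by rewrite [in RHS]trmx_mul (trmx_mul v^T) trmxK {1}vN1 mulNmx -!mulmxA -vE.
    have {}t : (v^T *m N1 *m e) 0 0 = - (v^T *m N1 *m e) 0 0.
      by rewrite {1}t !mxE.
    rewrite [LHS]mx11_scalar; move/eqP: t; rewrite -subr_eq0 opprK -mulr2n mulrn_eq0 /=.
    by move/eqP => ->; rewrite raddf0.
  have N'e : eval_mx alpha N' *m e = 0.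
    rewrite N'0 mulmxBl mulmxDl -!scalemxAl -!mulmxA [v^T *m _]mulmxA vN1e mulmx0 scaler0 addr0.
    by rewrite -vE /w hnorm_conjl mul_mx_scalar scalerA mulVf // scale1r subrr.
  rewrite ltnNge; apply/negP => N0_le.
  have /submxP[D N0E] : (N0 <= eval_mx alpha N')%MS.
    by rewrite -(geq_leqif (mxrank_leqif_sup _)) // N'K submxMl.
  by move/eqP: v0; apply; rewrite vE N0E -mulmxA N'e mulmx0.
- split.
  + exact: form_monic pN.
  + exact: form_real_den pN.
  + rewrite /N' /conj_mx map_mxD map_mxZ map_mxB !map_mxM.
    rewrite -/(conj_mx N) -/(conj_mx vP) -/(conj_mx wP) -/(conj_mx Y) -/(conj_mx Z).
    rewrite (form_real pN) conj_vP conj_wP conj_Z /= map_polyC /= cc -/Z.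
    by rewrite polyCN scaleNr -scalerN opprB.
  + rewrite -(form_gram pN); apply: (rank_one_correction_gram vNY wNZ (k := k%:P)).
    * by rewrite /vP map_trmx -map_mxM vv map_mx0.
    * by rewrite /wP map_trmx -map_mxM ww map_mx0.
    * by rewrite /vP /wP map_trmx -map_mxM hnormE map_scalar_mx.
    * by rewrite -polyCM ck polyCB; ring.
  move=> s t.
  have size_N i' j' : (size (N i' j') <= size p)%N.
    rewrite -(subrK (p *+ (i' == j')) (N i' j')).
    apply: leq_trans (size_polyD _ _) _; rewrite geq_max (ltnW (form_infty pN _ _)) /=.
    by case: eqP => _; rewrite ?mulr1n // mulr0n size_poly0.
  have p_gt0 : (0 < size p)%N by rewrite size_poly_gt0 monic_neq0 // (form_monic pN).
  have size_Y j' : (size (Y ord0 j') < size p)%N.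
    have [->|Y0'] := eqVneq (Y ord0 j') 0; first by rewrite size_poly0.
    have <- : size (('X - alpha%:P) * Y ord0 j')%R = (size (Y ord0 j')).+1.
      by rewrite size_monicM ?monicXsubC // size_XsubC.
    have := congr1 (fun M : 'rV_n => M ord0 j') vNY; rewrite [RHS]mxE => <-.
    rewrite mxE; apply: leq_trans (size_sum _ _ _) _; apply/bigmax_leqP => l _.
    by rewrite !mxE mul_polyC (leq_trans (size_scale_leq _ _)).
  have small_scale (a : C) (q : {poly C}) : (size q < size p)%N -> (size (a%:P * q)%R < size p)%N.
    by move=> qp; rewrite mul_polyC (leq_ltn_trans (size_scale_leq _ _)).
  have small_add (q q' : {poly C}) : (size q < size p)%N -> (size q' < size p)%N -> (size (q + q')%R < size p)%N.
    by move=> qp q'p; apply: leq_ltn_trans (size_polyD _ _) _; rewrite gtn_max qp.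
  rewrite mxE addrAC; apply: (small_add _ _); first exact: form_infty pN _ _.
  rewrite !mxE; apply: (small_scale _ _); rewrite !big_ord1 !mxE; apply: small_add; first exact/small_scale/size_Y.
  by rewrite size_polyN; apply: small_scale; rewrite size_map_poly; exact: size_Y.
Qed.

End Step.
End PoleReduction.

(** * Removing a root of the denominator *)

Section RealForms.
Variables (C : numClosedFieldType) (n : nat).

Lemma divide_form (q p : {poly C}) (N : 'M[{poly C}]_n) :
  q \is monic -> map_poly Num.conj q = q ->
  real_orthogonal_form (q * p) (q *: N) -> real_orthogonal_form p N.
Proof.
move=> mq cq [mp cp cN gN sN]; have q0 := monic_neq0 mq.
have mp' : p \is monic by rewrite monicMl in mp.
split=> //.
- by apply: (mulfI q0); rewrite -{1}cq -rmorphM.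
- apply/matrixP => i j; apply: (mulfI q0).
  by move/matrixP/(_ i j): cN; rewrite !mxE rmorphM /= cq.
- apply/matrixP => i j; apply: (mulfI (expf_neq0 2 q0)).
  move/matrixP/(_ i j): gN.
  have -> : (q *: N)^T = q *: N^T by rewrite linearZ.
  rewrite -scalemxAl -scalemxAr scalerA -expr2 mxE => ->.
  by rewrite !mxE exprMn mulrnAr.
move=> i j; have := sN i j; rewrite mxE -mulrnAr -mulrBr.
have p_gt0 : (0 < size p)%N by rewrite size_poly_gt0 monic_neq0.
have q_gt0 : (0 < size q)%N by rewrite size_poly_gt0.
have [->|r0] := eqVneq (N i j - p *+ (i == j)) 0; first by rewrite size_poly0.
rewrite !size_monicM ?(monic_neq0 mp') //; case: (size q) q_gt0 => // k _.
by rewrite !addSn /= ltn_add2l.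
Qed.

(** By reality p and N also vanish at the conjugate of alpha.  The common factor q is
X - alpha for a real root, and (X - alpha)(X - conj alpha) otherwise, so that q is
real in both cases. *)
Lemma divide_root (p : {poly C}) (N : 'M[{poly C}]_n) alpha :
  real_orthogonal_form p N -> root p alpha -> eval_mx alpha N = 0 ->
  exists q p' N', [/\ p = q * p', N = q *: N', (size p' < size p)%N,
    real_orthogonal_form p' N' &
    forall z, z != alpha -> z != alpha^* -> q.[z] != 0].
Proof.
move=> pN p0 N0.
have [q [p' [N' [mq cq sq pE [NE q0]]]]] : exists q p' N', [/\ q \is monic,
    map_poly Num.conj q = q, (1 < size q)%N, p = q * p' & N = q *: N' /\
    forall z, z != alpha -> z != alpha^* -> q.[z] != 0].
  have [p1 pE] := factor_theorem _ _ p0; rewrite mulrC in pE.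
  have [N1 NE] := root_factor_mx N0.
  have [ar|anr] := eqVneq alpha^* alpha.
    exists ('X - alpha%:P), p1, N1; split=> //; rewrite ?monicXsubC ?size_XsubC //.
      by rewrite rmorphB /= map_polyX map_polyC /= ar.
    by split=> // z za _; rewrite hornerXsubC subr_eq0.
  have ba0 : alpha^* - alpha != 0 by rewrite subr_eq0.
  have p1c : root p1 alpha^*.
    have : p.[alpha^*] = 0 by rewrite -(form_real_den pN) horner_map (eqP p0) rmorph0.
    by move/eqP; rewrite pE hornerM hornerXsubC mulf_eq0 (negPf ba0).
  have N1c : eval_mx alpha^* N1 = 0.
    have : eval_mx alpha^* N = 0 by rewrite -(eval_conj_mx pN) N0 map_mx0.
    move/eqP; rewrite NE eval_mxZ hornerXsubC scalemx_eq0 (negPf ba0) /=.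
    by move/eqP.
  have [p2 p1E] := factor_theorem _ _ p1c; rewrite mulrC in p1E.
  have [N2 N1E] := root_factor_mx N1c.
  exists (('X - alpha%:P) * ('X - alpha^*%:P)), p2, N2; split.
  - by rewrite monicMl ?monicXsubC.
  - rewrite rmorphM !rmorphB /= !map_polyX !map_polyC /= conjCK; exact: mulrC.
  - by rewrite size_monicM ?monicXsubC ?polyXsubC_eq0 // !size_XsubC.
  - by rewrite pE p1E mulrA.
  by rewrite NE N1E scalerA; split=> // z za zc; rewrite hornerM !hornerXsubC mulf_neq0 // subr_eq0.
exists q, p', N'; split=> //; last by apply: (divide_form mq cq); rewrite -pE -NE.
have p'0 : p' != 0.
  by apply: contraTneq (form_monic pN) => p'0; rewrite pE p'0 mulr0 monicE lead_coef0 eq_sym oner_eq0.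
rewrite pE size_monicM //; case: (size q) sq => [//|[//|k]] _.
by rewrite !addSn /= ltnS leq_addl.
Qed.

Lemma horner_large_eq0 (q : {poly C}) m :
  (forall k, (m <= k)%N -> q.[k%:R] = 0) -> q = 0.
Proof.
move=> q0; apply/eqP/negPn/negP => qn0.
have := @max_poly_roots _ q [seq k%:R | k <- iota m (size q)] qn0.
rewrite size_map size_iota ltnn => H; suff : false by []; apply: H.
  by apply/allP => x /mapP[k]; rewrite mem_iota => /andP[mk _] ->; apply/eqP/q0.
have natr_inj : injective (fun k : nat => k%:R : C).
  by move=> a b /eqP; rewrite eqr_nat => /eqP.
by rewrite (map_inj_uniq natr_inj) iota_uniq.
Qed.

End RealForms.

(** * Loops with a real polynomial form are products of simple elements *)

Section Generation.
Variables (R : realType) (n : nat).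
Local Notation C := R[i].

Lemma simple_mxE (alpha : C) (L : isotropic_line C n) (v : 'cV[C]_n) z :
  v != 0 -> (v^T <= L)%MS -> z != alpha -> z != alpha^* ->
  simple_mx alpha L (Some z) = simple_factor alpha v z.
Proof.
move=> v0 vL za zac; rewrite /simple_mx pi_midE (pi_conjE v0 vL) (pi_lineE v0 vL).
rewrite /simple_factor; move: (map_mx _ v *m _) (v *m _) => P Q.
have z1 : z - alpha != 0 by rewrite subr_eq0.
have z2 : z - alpha^* != 0 by rewrite subr_eq0.
have k0 : hnorm v != 0 by rewrite hnorm_eq0.
by apply/matrixP => i j; rewrite !mxE; field; rewrite z1 z2.
Qed.

Definition represented (g : loop R n) (p : {poly C}) (N : 'M[{poly C}]_n) : Prop :=
  (forall z, dom g (Some z) -> eval_mx z N = p.[z] *: g (Some z)) /\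
  (dom g None -> g None = 1%:M).

(** Cancelling a factor q of p and N determines the loop outside the roots of q
only. *)
Definition restrict_loop (g : loop R n) (a b : C) : loop R n.
Proof.
apply: (@Loop _ _ (dom g `&` off2 a b) g).
- by apply: openI; [exact: dom_open|exact: off2_open].
- by apply: denseI; [exact: dom_open|exact: dom_dense|exact: off2_dense].
- by move=> x [gx _]; exact: eval_holomorphic.
- by move=> x [gx _]; exact: eval_special_orthogonal.
Defined.

Lemma pi_restrict g a b : \pi_(loop_group R n) (restrict_loop g a b) = \pi_(loop_group R n) g.
Proof. by apply/eqP/Defs.piP; apply: agree_sub => // x []. Qed.

Section Closure.
Variable M : set (loop_group R n).
Hypotheses (M_closed : group_closed (mem M)) (M_simple : @simple_elements R n `<=` M).

Lemma closed_mulV x y : M x -> M (classM x y) -> M y.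
Proof.
move=> Mx Mxy.
have {}Mx : x \in mem M by rewrite inE.
have {}Mxy : classM x y \in mem M by rewrite inE.
suff : y \in mem M by rewrite inE.
have -> : y = (x^-1 * (x * y))%g by rewrite mulKg.
by apply: group_closedM => //; exact: group_closedV.
Qed.

(** Induction on the rank of N(alpha), by [reduce_rank]. *)
Lemma clear_root (p : {poly C}) alpha : root p alpha -> forall r g N,
  (\rank (eval_mx alpha N) <= r)%N -> real_orthogonal_form p N -> represented g p N ->
  exists g' N', [/\ real_orthogonal_form p N', eval_mx alpha N' = 0,
    represented g' p N' & M (\pi_(loop_group R n) g') -> M (\pi_(loop_group R n) g)].
Proof.
move=> p0; elim=> [|r IH] g N rkN pN gN.
  by exists g, N; split=> //; apply/eqP; rewrite -mxrank_eq0 -leqn0.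
have [N0|N0] := eqVneq (eval_mx alpha N) 0; first by exists g, N.
have [ar|anr] := eqVneq alpha^* alpha.
  by move/eqP: N0; case; exact: (eval_real_root0 pN p0 ar).
have [v [N' [v0 vv pN' rkN' N'E]]] := reduce_rank pN p0 anr N0.
have [L vL] := vector_line v0 vv.
have g'N' : represented (loopM (simple_loop alpha L) g) p N'.
  split=> [z [[za zac] gz]|[_ gI]]; last by rewrite /= (gN.2 gI) mulmx1.
  have {}za : z != alpha by apply/eqP => E; apply: za; rewrite E.
  have {}zac : z != alpha^* by apply/eqP => E; apply: zac; rewrite E.
  rewrite -[loopM _ _ _]/(simple_mx alpha L (Some z) *m g (Some z)).
  by rewrite N'E // (simple_mxE v0 vL) // (gN.1 z gz) scalemxAr.
have [|g'' [N'' [pN'' N''0 gN'' Mg]]] := IH _ _ _ pN' g'N'.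
  by rewrite -ltnS (leq_trans rkN').
exists g'', N''; split=> // /Mg; rewrite -Defs.pi_mul; apply: closed_mulV.
apply: M_simple; exists alpha, L; split=> //.
by apply: contraNN anr => /CrealP ->.
Qed.

(** Induction on the degree of p: [clear_root] makes N vanish at a root of p, and
[divide_root] then lowers the degree. *)
Lemma represented_mem k g (p : {poly C}) (N : 'M[{poly C}]_n) : (size p <= k)%N ->
  real_orthogonal_form p N -> represented g p N -> M (\pi_(loop_group R n) g).
Proof.
elim: k g p N => [|k IH] g p N sp pN gN.
  by have := form_monic pN; rewrite (size_poly_leq0P _ sp) monicE lead_coef0 eq_sym oner_eq0.
have [p1|] := eqVneq (size p) 1%N.
  have {}p1 : p = 1.
    have /size_poly1P[c c0 pc] : size p == 1%N by rewrite p1.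
    by have := form_monic pN; rewrite pc monicE lead_coefC => /eqP ->.
  have N1 z : eval_mx z N = 1%:M.
    apply/matrixP => i j; have := form_infty pN i j.
    rewrite p1 size_poly1 ltnS leqn0 size_poly_eq0 subr_eq0 => /eqP Nij.
    by rewrite !mxE Nij /horner_eval hornerMn hornerE.
  have -> : \pi_(loop_group R n) g = \pi_(loop_group R n) (loop1 R n).
    apply/eqP/Defs.piP; apply: agree_sub => //= -[z gz|]; last exact: gN.2.
    by have := gN.1 z gz; rewrite N1 p1 hornerE scale1r.
  by have [/set_mem] := M_closed.
move=> /closed_rootP[alpha p0].
have [g' [N' [pN' N'0 gN' Mg]]] := clear_root p0 (leqnn _) pN gN.
apply: Mg.
have [q [p' [N'' [pE NE sp' pN'' q0]]]] := divide_root pN' p0 N'0.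
rewrite -(pi_restrict g' alpha alpha^*); apply: (IH _ p' N'' _ pN'').
  by rewrite -ltnS (leq_trans sp').
split=> [z [g'z [za zac]]|[g'I _]] /=; last exact: gN'.2.
have {}za : z != alpha by apply/eqP => E; apply: za; rewrite E.
have {}zac : z != alpha^* by apply/eqP => E; apply: zac; rewrite E.
apply: (scalerI (q0 z za zac)); rewrite -eval_mxZ -NE (gN'.1 z g'z).
by rewrite pE hornerM scalerA.
Qed.

End Closure.

(** Multiplying p and N by the conjugate of p makes the denominator real.  Reality
and orthogonality of the loop then become polynomial identities, since they
hold at all large integers, which are real points of its domain. *)
Lemma loop_real_form (g : loop R n) : Defs.rational g -> negative g -> real_loop g ->
  exists p N, real_orthogonal_form p N /\ represented g p N.
Proof.
move=> rat_g neg_g real_g.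
have [p [N [mp sN gN]]] := loop_polynomial_form rat_g neg_g.
have [K [r gr]] := loop_bound_infinity neg_g.
have large k : (Num.bound `|r| <= k)%N -> dom g (Some k%:R).
  move=> rk; have [] := gr k%:R _ => //.
  rewrite -(rmorph_nat (real_complex R)) modulusR normr_nat.
  apply: le_trans (_ : (Num.bound `|r|)%:R <= _); last by rewrite ler_nat.
  exact: le_trans (ler_norm r) (ltW (archi_boundP (normr_ge0 r))).
have gk k : (Num.bound `|r| <= k)%N -> map_mx Num.conj (g (Some k%:R)) = g (Some k%:R).
  move=> rk; have := real_g _ (large k rk); rewrite /= rmorph_nat; apply; exact: large.
have [gram evN] : (forall k, (Num.bound `|r| <= k)%N ->
    (g (Some k%:R))^T *m g (Some k%:R) = 1%:M) /\
    (forall z, dom g (Some z) -> eval_mx z N = p.[z] *: g (Some z)).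
  split=> [k /large /eval_special_orthogonal/special_orthogonalP[]//|z gz].
  by apply/matrixP => i j; rewrite !mxE; exact: gN.
pose pc := map_poly Num.conj p.
have pcc : map_poly Num.conj pc = p by rewrite -map_poly_comp map_poly_id // => x _; exact: conjCK.
have mpc : pc \is monic by rewrite monic_map.
have pcz k : pc.[k%:R] = p.[k%:R]^* by rewrite -{1}(rmorph_nat Num.conj) horner_map.
have evN2 k : (Num.bound `|r| <= k)%N ->
    eval_mx k%:R (pc *: N) = (p.[k%:R]^* * p.[k%:R]) *: g (Some k%:R).
  by move=> rk; rewrite eval_mxZ pcz evN ?scalerA //; exact: large.
exists (pc * p), (pc *: N); split; last first.
  split=> [z gz|]; last by case: neg_g.
  by rewrite eval_mxZ evN // hornerM scalerA.
split.
- by rewrite monicMl.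
- by rewrite rmorphM /= pcc mulrC.
- apply/matrixP => i j; apply/eqP; rewrite -subr_eq0; apply/eqP.
  apply: (@horner_large_eq0 _ _ (Num.bound `|r|)) => k rk.
  have := congr1 (fun A : 'M_n => (map_mx Num.conj A) i j) (evN2 k rk).
  rewrite map_mxZ gk // rmorphM /= conjCK mulrC -evN2 // [LHS]mxE ![eval_mx _ _ _ _]mxE => H.
  have -> : conj_mx (pc *: N) i j = map_poly Num.conj ((pc *: N) i j) by rewrite mxE.
  rewrite hornerD hornerN -{1}(rmorph_nat Num.conj) horner_map /=.
  by move: H; rewrite /horner_eval => ->; rewrite subrr.
- apply/matrixP => i j; apply/eqP; rewrite -subr_eq0; apply/eqP.
  apply: (@horner_large_eq0 _ _ (Num.bound `|r|)) => k rk.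
  have : eval_mx k%:R ((pc *: N)^T *m (pc *: N)) = ((pc * p).[k%:R] ^+ 2)%:M.
    have tZ (c : C) (A : 'M_n) : (c *: A)^T = c *: A^T by rewrite linearZ.
    rewrite eval_mxM eval_mx_tr evN2 // tZ -scalemxAl -scalemxAr gram //.
    by rewrite hornerM pcz scalerA -expr2 scale_scalar_mx mulr1.
  move/matrixP/(_ i j); rewrite mxE [RHS]mxE => H.
  rewrite hornerD hornerN [X in _ - X.[_]]mxE hornerMn horner_exp.
  by move: H; rewrite /horner_eval => ->; rewrite subrr.
move=> i j; rewrite mxE -mulrnAr -mulrBr.
have [->|r0] := eqVneq (N i j - p *+ (i == j)) 0.
  by rewrite mulr0 size_poly0 size_poly_gt0 monic_neq0 // monicMl.
rewrite !size_monicM ?(monic_neq0 mp) //; have := sN i j.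
have : (0 < size pc)%N by rewrite size_poly_gt0 monic_neq0.
by case: (size pc) => // m _; rewrite !addSn /= ltn_add2l.
Qed.

End Generation.

Lemma scaler_comb (K : comNzRingType) (V : lmodType K) (w a b : K) (X Y Z : V) :
  w *: (a *: X + Y + b *: Z) = (w * a) *: X + w *: Y + (w * b) *: Z.
Proof. by rewrite !scalerDr !scalerA. Qed.

(** * The simple elements and the group that they generate *)

Section Members.
Variables (R : realType) (n : nat).
Local Notation C := R[i].

Lemma derivable_affine (a b w : C) : derivable ((fun w => a + b * w) : C^o -> C^o) w 1.
Proof.
apply: (@derivableD _ C^o C^o (cst a)); first exact: derivable_cst.
by apply: derivableZ; exact: derivable_id.
Qed.

Lemma derivable_fraction (f g : C -> C) (w : C) :
  derivable (f : C^o -> C^o) w 1 -> derivable (g : C^o -> C^o) w 1 -> g w != 0 ->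
  derivable ((fun w => f w / g w) : C^o -> C^o) w 1.
Proof.
move=> df dg g0; apply: (@derivableM _ C^o f); first exact: df.
by apply: (@derivableV _ C^o); [exact: g0|exact: dg].
Qed.

Lemma near_affine_neq0 (a b : C) : a != 0 -> \forall w \near (0 : C^o), a + b * w != 0.
Proof.
move=> a0; have [->|b0] := eqVneq b 0; first by near=> w; rewrite mul0r addr0.
have ab0 : (0 : C) != - (a / b) by rewrite eq_sym oppr_eq0 mulf_neq0 ?invr_eq0.
apply: filterS (near_neq ab0) => w; apply: contraNneq => abw.
rewrite -addr_eq0 -(mulrI_eq0 _ (mulfI b0)) mulrDr mulrC addrC.
by rewrite [b * (a / b)]mulrC divfK // [w * b]mulrC abw.
Unshelve. all: by end_near. Qed.

Lemma cdifferentiable_comb (a b c : C -> C) (P Q S : 'M[C]_n) (w : C) :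
  derivable (a : C^o -> C^o) w 1 -> derivable (b : C^o -> C^o) w 1 ->
  derivable (c : C^o -> C^o) w 1 ->
  cdifferentiable_at (fun w => a w *: P + b w *: Q + c w *: S) w.
Proof.
move=> da db dc i j.
have -> : (fun w : C^o => (a w *: P + b w *: Q + c w *: S) i j : C^o) =
    (fun w : C^o => P i j * a w + Q i j * b w + S i j * c w : C^o).
  by apply/funext => u; rewrite !mxE (mulrC (a u)) (mulrC (b u)) (mulrC (c u)).
apply: (@derivableD _ C^o C^o); last by apply: derivableZ; exact: dc.
by apply: (@derivableD _ C^o C^o); apply: derivableZ; [exact: da|exact: db].
Qed.

Lemma meromorphicM (f g : sphere R -> 'M[C]_n) : meromorphic f -> meromorphic g ->
  meromorphic (fun x => f x *m g x).
Proof.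
move=> mf mg a; have [k [h [dh fh]]] := mf a; have [l [u [du gu]]] := mg a.
exists (k + l)%N, (fun w => h w *m u w); split.
  by move: dh du; apply: filterS2 => w; exact: cdifferentiable_atM.
by move: fh gu; apply: filterS2 => w <- <-; rewrite -scalemxAl -scalemxAr scalerA exprD.
Qed.

Lemma meromorphic_tr (f : sphere R -> 'M[C]_n) : meromorphic f ->
  meromorphic (fun x => (f x)^T).
Proof.
move=> mf a; have [k [h [dh fh]]] := mf a; exists k, (fun w => (h w)^T); split.
  apply: filterS dh => w dhw i j.
  have -> : (fun w : C^o => (h w)^T i j : C^o) = (fun w : C^o => h w j i : C^o).
    by apply/funext => u; rewrite mxE.
  exact: dhw.
by apply: filterS fh => w <-; rewrite linearZ.
Qed.

Lemma meromorphic_cst (A : 'M[C]_n) : meromorphic (fun _ : sphere R => A).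
Proof.
move=> a; exists 0%N, (fun=> A); split.
  by near=> w => i j; exact: derivable_cst.
by near=> w; rewrite expr0 scale1r.
Unshelve. all: by end_near. Qed.

Section Simple.
Variables (alpha : C) (L : isotropic_line C n).
Hypothesis (alpha_nreal : alpha \isn't Num.real).

Let ac0 : alpha - alpha^* != 0.
Proof. by rewrite subr_eq0 eq_sym; apply: contraNneq alpha_nreal => /CrealP. Qed.

(** The poles alpha and conj alpha are simple, whence the exponent 1 there; at any
other point, including infinity, the entries are Moebius functions without pole
by [simple_chart]. *)
Lemma simple_meromorphic : meromorphic (simple_mx alpha L).
Proof.
have ca0 : alpha^* - alpha != 0 by rewrite -opprB oppr_eq0.
move=> a; have [->|aa] := pselect (a = Some alpha).
  exists 1%N, (fun w => (alpha - alpha^* + 1 * w) *: pi_conj L + (0 + 1 * w) *: pi_mid L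
    + ((0 + 1 * w) * w / (alpha - alpha^* + 1 * w)) *: pi_line L); split.
    apply: filterS (near_affine_neq0 1 ac0) => w w0.
    apply: cdifferentiable_comb; [exact: derivable_affine|exact: derivable_affine|].
    apply: derivable_fraction; [|exact: derivable_affine|exact: w0].
    apply: (@derivableM _ C^o (fun w => 0 + 1 * w)); first exact: derivable_affine.
    exact: derivable_id.
  have := nbhs_dnbhs (near_affine_neq0 1 ac0); have := dnear_neq 0 (0 : C).
  apply: filterS2 => w w0 aw0; rewrite /= !mul1r add0r in aw0 *.
  have e1 : alpha + w - alpha = w by ring.
  have e2 : alpha + w - alpha^* = alpha - alpha^* + w by ring.
  rewrite e1 e2 expr1 scaler_comb.
  by rewrite [w * (_ / w)]mulrC divfK // mulrA.
have [->|ac] := pselect (a = Some alpha^*).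
  exists 1%N, (fun w => ((0 + 1 * w) * w / (alpha^* - alpha + 1 * w)) *: pi_conj L
    + (0 + 1 * w) *: pi_mid L + (alpha^* - alpha + 1 * w) *: pi_line L); split.
    apply: filterS (near_affine_neq0 1 ca0) => w w0.
    apply: cdifferentiable_comb; [|exact: derivable_affine|exact: derivable_affine].
    apply: derivable_fraction; [|exact: derivable_affine|exact: w0].
    apply: (@derivableM _ C^o (fun w => 0 + 1 * w)); first exact: derivable_affine.
    exact: derivable_id.
  have := nbhs_dnbhs (near_affine_neq0 1 ca0); have := dnear_neq 0 (0 : C).
  apply: filterS2 => w w0 aw0; rewrite /= !mul1r add0r in aw0 *.
  have e1 : alpha^* + w - alpha^* = w by ring.
  have e2 : alpha^* + w - alpha = alpha^* - alpha + w by ring.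
  have e3 : w * ((alpha^* - alpha + w) / w) = alpha^* - alpha + w by rewrite mulrC divfK.
  have e4 : w * (w / (alpha^* - alpha + w)) = w * w / (alpha^* - alpha + w) by exact: mulrA.
  by rewrite e1 e2 expr1 scaler_comb e3 e4.
have [p [q [r [s [p0 r0 E]]]]] := simple_chart L (conj aa ac).
exists 0%N, (fun w => moebius p q r s w *: pi_conj L + 1 *: pi_mid L + moebius r s p q w *: pi_line L).
split; last by near=> w; rewrite expr0 !scale1r E.
have := near_affine_neq0 s r0; have := near_affine_neq0 q p0.
apply: filterS2 => w pw rw; apply: cdifferentiable_comb.
- by apply: derivable_fraction; [exact: derivable_affine|exact: derivable_affine|exact: rw].
- exact: derivable_cst.
- by apply: derivable_fraction; [exact: derivable_affine|exact: derivable_affine|exact: pw].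
Unshelve. all: by end_near. Qed.

Lemma simple_real x :
  map_mx Num.conj (simple_mx alpha L (sphere_conj x)) = simple_mx alpha L x.
Proof.
case: x => [z|]; last by rewrite /= map_mx1.
by rewrite /= conj_projections !rmorphM !fmorphV !rmorphB /= !conjCK.
Qed.

End Simple.

Lemma minus_tau_simple : @simple_elements R n `<=` @loop_group_minus_tau R n.
Proof.
move=> _ [alpha [L [a_nreal ->]]]; exists (simple_loop alpha L) => //; split.
- by exists (simple_mx alpha L); split=> //; exact: simple_meromorphic.
- by split=> //; split.
- by move=> x _ _; exact: simple_real.
Qed.

Lemma minus_tau_closed : group_closed (mem (@loop_group_minus_tau R n)).
Proof.
split.
  apply/mem_set; exists (loop1 R n) => //; split=> //.
    by exists (fun=> 1%:M); split=> //; exact: meromorphic_cst.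
  by move=> x _ _; rewrite /= map_mx1.
move=> _ _ /set_mem[g [[f [mf gf]] [gI g1] real_g] <-] /set_mem[h [[f' [mf' hf']] [hI h1] real_h] <-].
apply/mem_set; exists (loopM g (loopV h)).
  split.
  - exists (fun x => f x *m (f' x)^T); split.
      by apply: meromorphicM => //; exact: meromorphic_tr.
    by move=> x [gx hx] /=; rewrite gf // hf'.
  - by split=> //=; rewrite g1 h1 mul1mx trmx1.
  - move=> x [gx hx] [gcx hcx] /=.
    by rewrite map_mxM -map_trmx real_g // real_h.
by rewrite -Defs.pi_mul -Defs.pi_inv.
Qed.

End Members.

Theorem theorem5p1 (R : realType) (n : nat) :
  generated (@simple_elements R n) = @loop_group_minus_tau R n.
Proof.
apply/seteqP; split.
  by apply: smallest_sub; [exact: minus_tau_closed|exact: minus_tau_simple].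
move=> _ [g [rat_g neg_g real_g] <-] M [M_closed M_simple].
have [p [N [pN gN]]] := loop_real_form rat_g neg_g real_g.
exact: (@represented_mem R n M M_closed M_simple _ g p N (leqnn _) pN gN).
Qed.
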